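(* Let $\mathcal H$ be a complex Hilbert space, let $T=(T_1,\dots,T_n)$ be a commuting multicontraction on $\mathcal H$, and let $\lambda\in\mathbb B^n$. Let $\Omega:\mathcal D_{\phi_\lambda(T)}\to\mathcal D_T$ and $\Omega_*:\mathcal D_{\phi_\lambda(T)^*}\to\mathcal D_{T^*}$ be the (well-defined, isometric) operators determined by $$\Omega D_{\phi_\lambda(T)}x=D_T(I-\boldsymbol\lambda^*T)^{-1}D_{\boldsymbol\lambda}x\quad(x\in\mathcal H^n),\qquad \Omega_*D_{\phi_\lambda(T)^*}x=D_{T^*}(I-\boldsymbol\lambda T^* )^{-1}D_{\boldsymbol\lambda^*}x\quad(x\in\mathcal H).$$ Then: (i) $\Omega$ and $\Omega_*$ are unitary operators. (ii) The characteristic function $z\mapsto\theta_{\phi_\lambda(T)}(z)$ coincides with the function $z\mapsto\theta_T(\phi_\lambda(z))$ on $\mathbb B^n$.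
   Context: Fix an integer $n\ge1$; $\mathbb B^n$ is the open unit ball of $\mathbb C^n$, and $\langle z,w\rangle=\sum_i z_i\overline{w_i}$. $\mathcal H^n$ is the direct sum of $n$ copies of $\mathcal H$. A commuting multicontraction on $\mathcal H$ is an $n$-tuple $T=(T_1,\dots,T_n)$ of pairwise commuting bounded operators on $\mathcal H$ with $\sum_i T_iT_i^*\le 1_{\mathcal H}$. The same letter $T$ denotes the row contraction $T:\mathcal H^n\to\mathcal H$, $(h_1,\dots,h_n)\mapsto\sum_iT_ih_i$. For a contraction $C:\mathcal E_1\to\mathcal E_2$ between Hilbert spaces, $D_C=(1-C^*C)^{1/2}$ and $\mathcal D_C=\overline{D_C\mathcal E_1}$; so $\mathcal D_T\subset\mathcal H^n$, $\mathcal D_{T^*}\subset\mathcal H$. For $z\in\mathbb B^n$ let $\mathbf z=(z_11_{\mathcal H}\ \cdots\ z_n1_{\mathcal H}):\mathcal H^n\to\mathcal H$. The characteristic function of $T$ is $\theta_T:\mathbb B^n\to\mathcal L(\mathcal D_T,\mathcal D_{T^*})$, $\theta_T(z)=\big(-T+D_{T^*}(1_{\mathcal H}-\mathbf zT^* )^{-1}\mathbf zD_T\big)|_{\mathcal D_T}$. Two analytic functions $\Theta:\mathbb B^n\to\mathcal L(\mathcal E_1,\mathcal E_2)$ and $\Theta':\mathbb B^n\to\mathcal L(\mathcal E_1',\mathcal E_2')$ coincide if there are unitary operators $U_i:\mathcal E_i\to\mathcal E_i'$, $i=1,2$, with $U_2\Theta(z)=\Theta'(z)U_1$ for all $z\in\mathbb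 B^n$. For $\lambda\in\mathbb B^n$, the involutive automorphism $\phi_\lambda$ of $\mathbb B^n$ is $\phi_\lambda(z)=\lambda-\frac{s_\lambda}{1-\langle z,\lambda\rangle}\big(z-(1-s_\lambda)P_\lambda z\big)$, where $s_\lambda=(1-|\lambda|^2)^{1/2}$ and $P_\lambda$ is the orthogonal projection onto the span of $\lambda$. Let $\boldsymbol\lambda=\lambda\otimes 1_{\mathcal H}=(\lambda_11_{\mathcal H}\ \cdots\ \lambda_n1_{\mathcal H}):\mathcal H^n\to\mathcal H$, a strict contraction. The tuple $\phi_\lambda(T)$ is defined by the analytic functional calculus; it is again a commuting multicontraction, and as a row operator $\phi_\lambda(T)=\boldsymbol\lambda-D_{\boldsymbol\lambda^*}(1_{\mathcal H}-T\boldsymbol\lambda^* )^{-1}TD_{\boldsymbol\lambda}$. *)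

(* Defs.v *)
From HB Require Import structures.
From mathcomp Require Import all_boot all_order all_algebra.
From mathcomp Require Import complex ring.
From mathcomp Require Import boolp classical_sets reals topology normedtype.

Set Implicit Arguments.
Unset Strict Implicit.
Unset Printing Implicit Defensive.

Import Order.TTheory GRing.Theory Num.Theory.
Import numFieldNormedType.Exports.

Local Open Scope classical_set_scope.
Local Open Scope ring_scope.

HB.mixin Record CompleteNormedModule_isHilbert (C : numClosedFieldType) H
    & CompleteNormedModule C H := {
  inner : H -> H -> C ;
  inner_linearl : forall (a : C) (x y z : H),
    inner (a *: x + y) z = a * inner x z + inner y z ;
  innerC : forall x y : H, inner y x = (inner x y)^* ;
  innerxx : forall x : H, inner x x = `|x| ^+ 2
}.

#[short(type="hilbertType")]
HB.structure Definition Hilbert (C : numClosedFieldType) :=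
  {H of CompleteNormedModule C H & CompleteNormedModule_isHilbert C H}.

Section inner_norm.
Variables (C : numClosedFieldType) (V : lmodType C) (B : V -> V -> C).
Hypothesis Bl : forall (a : C) (x y z : V),
  B (a *: x + y) z = a * B x z + B y z.
Hypothesis BC : forall x y, B y x = (B x y)^*.
Hypothesis Bge0 : forall x, 0 <= B x x.
Hypothesis Beq0 : forall x, B x x = 0 -> x = 0.

Let BDl x y z : B (x + y) z = B x z + B y z.
Proof. by have := Bl 1 x y z; rewrite scale1r mul1r. Qed.
Let B0l z : B 0 z = 0.
Proof. by apply: (addrI (B 0 z)); rewrite -BDl !addr0. Qed.
Let BZl a x z : B (a *: x) z = a * B x z.
Proof. by have := Bl a x 0 z; rewrite addr0 B0l addr0. Qed.
Let BDr x y z : B z (x + y) = B z x + B z y.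
Proof. by rewrite BC BDl rmorphD /= -!BC. Qed.
Let BZr a x z : B z (a *: x) = a^* * B z x.
Proof. by rewrite BC BZl rmorphM /= -BC. Qed.

Definition inner_norm x := sqrtC (B x x).

Lemma inner_normZ a x : inner_norm (a *: x) = `|a| * inner_norm x.
Proof.
rewrite /inner_norm BZl BZr mulrA -normCK sqrtCM ?nnegrE ?exprn_ge0 //.
by rewrite sqrCK.
Qed.

Lemma inner_norm_eq0 x : inner_norm x = 0 -> x = 0.
Proof. by move/eqP; rewrite sqrtC_eq0 => /eqP/Beq0. Qed.

Lemma inner_CauchySchwarz x y : `|B x y| ^+ 2 <= B x x * B y y.
Proof.
have [->|y0] := eqVneq y 0.
  by rewrite [B x 0]BC !B0l rmorph0 normr0 expr0n mulr0.
have By : 0 < B y y.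
  by rewrite lt_def Bge0 andbT; apply: contra_neq y0 => /Beq0.
have := Bge0 (x + (- (B x y / B y y)) *: y).
rewrite BDl !BDr !BZl !BZr [B y x]BC rmorphN rmorphM /= fmorphV /=.
rewrite (geC0_conj (Bge0 y)).
set b := B y y; set c := B x y.
have -> : B x x + - (c^* / b) * c + (- (c / b) * c^* + - (c / b) * (- (c^* / b) * b))
    = B x x - c * c^* / b.
  by field; rewrite gt_eqF.
by rewrite subr_ge0 ler_pdivrMr// normCK.
Qed.

Lemma ler_inner_normD x y : inner_norm (x + y) <= inner_norm x + inner_norm y.
Proof.
have n0 z : 0 <= inner_norm z by rewrite sqrtC_ge0.
rewrite -(@ler_pXn2r _ 2) ?nnegrE ?addr_ge0 // sqrrD !sqrtCK BDl !BDr.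
rewrite addrA lerD2r -addrA lerD2l [B y x]BC.
have CS : `|B x y| <= inner_norm x * inner_norm y.
  rewrite -(@ler_pXn2r _ 2) ?nnegrE ?mulr_ge0 // exprMn !sqrtCK.
  exact: inner_CauchySchwarz.
have -> : B x y + (B x y)^* = 'Re (B x y) *+ 2.
  by rewrite ReE -[in RHS]mulr_natr divfK ?pnatr_eq0.
by rewrite lerMn2r /=; apply: le_trans CS; case: (leif_Re_Creal (B x y)).
Qed.

End inner_norm.

Section hilbert_theory.
Variables (C : numClosedFieldType) (H : hilbertType C).
Implicit Types x y : H.

Lemma inner_ge0 x : 0 <= inner x x.
Proof. by rewrite innerxx exprn_ge0. Qed.

Lemma inner_eq0 x : inner x x = 0 -> x = 0.
Proof. by move/eqP; rewrite innerxx sqrf_eq0 normr_eq0 => /eqP. Qed.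

End hilbert_theory.

(* The Hilbert direct sum of [n] copies of [H]; a fresh alias is needed because
   its norm is the l2 one. *)
Definition hsum (n : nat) (H : Type) := {ffun 'I_n -> H}.

Section hsum.
Variables (C : numClosedFieldType) (n : nat) (H : hilbertType C).

HB.instance Definition _ := GRing.Lmodule.on (hsum n H).

Definition hsum_inner (x y : hsum n H) : C := \sum_i inner (x i) (y i).

Let hsum_innerl (a : C) (x y z : hsum n H) :
  hsum_inner (a *: x + y) z = a * hsum_inner x z + hsum_inner y z.
Proof.
rewrite /hsum_inner mulr_sumr -big_split; apply: eq_bigr => i _ /=.
by rewrite !ffunE inner_linearl.
Qed.

Let hsum_innerC (x y : hsum n H) : hsum_inner y x = (hsum_inner x y)^*.
Proof.
by rewrite /hsum_inner rmorph_sum; apply: eq_bigr => i _; rewrite innerC.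
Qed.

Let hsum_inner_ge0 (x : hsum n H) : 0 <= hsum_inner x x.
Proof. by apply: sumr_ge0 => i _; exact: inner_ge0. Qed.

Let hsum_inner_eq0 (x : hsum n H) : hsum_inner x x = 0 -> x = 0.
Proof.
move=> /eqP; rewrite psumr_eq0 => [/allP x0|i _]; last exact: inner_ge0.
apply/ffunP => i; rewrite ffunE; apply: inner_eq0; apply/eqP.
exact: x0 (mem_index_enum i).
Qed.

HB.instance Definition _ := Lmodule_isNormed.Build C (hsum n H)
  (ler_inner_normD hsum_innerl hsum_innerC hsum_inner_ge0 hsum_inner_eq0)
  (inner_normZ hsum_innerl hsum_innerC hsum_inner_ge0)
  (inner_norm_eq0 hsum_inner_eq0).

Let hsum_innerxx (x : hsum n H) : hsum_inner x x = `|x| ^+ 2.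
Proof. by rewrite [`|x|]/(inner_norm hsum_inner x) sqrtCK. Qed.

Let hsum_sqr_norm (x : hsum n H) : `|x| ^+ 2 = \sum_i `|x i| ^+ 2.
Proof. by rewrite -hsum_innerxx; apply: eq_bigr => i _; rewrite innerxx. Qed.

Lemma hsum_coord_le (x : hsum n H) (i : 'I_n) : `|x i| <= `|x|.
Proof.
rewrite -(@ler_pXn2r _ 2) ?nnegrE // hsum_sqr_norm (bigD1 i) //= lerDl.
by apply: sumr_ge0 => j _; exact: exprn_ge0.
Qed.

Let hsum_norm_lt (x : hsum n H) (e : C) : 0 < e ->
  (forall i, `|x i| < e / n.+1%:R) -> `|x| < e.
Proof.
move=> e0 xe; have e0' := ltW e0.
rewrite -(@ltr_pXn2r _ 2) ?nnegrE // hsum_sqr_norm.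
apply: (@le_lt_trans _ _ (\sum_(i < n) (e / n.+1%:R) ^+ 2)).
  by apply: ler_sum => i _; rewrite ler_pXn2r ?nnegrE ?divr_ge0 // ltW.
rewrite sumr_const card_ord expr_div_n -[X in X < _]mulr_natr -mulrA gtr_pMr ?exprn_gt0//.
rewrite mulrC ltr_pdivrMr ?exprn_gt0// mul1r -natrX ltr_nat.
by rewrite (leq_trans (ltnSn n))// leq_pmulr.
Qed.

Let hsum_complete (F : set_system (hsum n H)) :
  ProperFilter F -> cauchy F -> cvg F.
Proof.
move=> FF /cauchyP Fc.
have Fci i : cauchy ((fun x : hsum n H => x i) @ F).
  apply/cauchyP => e /Fc[x Fx]; exists (x i).
  suff : F [set y : hsum n H | ball (x i) e (y i)] by [].
  apply: filterS Fx => y; rewrite /= -!ball_normE /=; apply: le_lt_trans.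
  by have := hsum_coord_le (x - y) i; rewrite !ffunE.
pose l : hsum n H := [ffun i => lim ((fun x : hsum n H => x i) @ F)].
apply/cvg_ex; exists l; apply/cvgrPdist_lt => e e0.
have : F [set x : hsum n H | forall i, `|l i - x i| < e / n.+1%:R].
  apply: (@filter_forall _ _ (fun i x => `|l i - x i| < e / n.+1%:R) F _) => i.
  have /cvgrPdist_lt := @cauchy_cvg H _ (fmap_proper_filter _ FF) (Fci i).
  by rewrite /l ffunE; apply; exact: divr_gt0.
apply: filterS => x lx; apply: hsum_norm_lt => // i.
by have := lx i; rewrite !ffunE.
Qed.

HB.instance Definition _ := Uniform_isComplete.Build (hsum n H) hsum_complete.

HB.instance Definition _ := CompleteNormedModule_isHilbert.Build C (hsum n H)
  hsum_innerl hsum_innerC hsum_innerxx.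

End hsum.

Record bounded_op (C : numClosedFieldType) (H K : hilbertType C) := BoundedOp {
  bop_fun :> {linear H -> K} ;
  bop_continuous : continuous bop_fun
}.
Notation "''L' ( H , K )" := (bounded_op H K)
  (at level 8, format "''L' ( H ,  K )") : type_scope.

Section bounded_op.
Variables (C : numClosedFieldType) (H K : hilbertType C).

HB.instance Definition _ := gen_eqMixin 'L(H, K).
HB.instance Definition _ := gen_choiceMixin 'L(H, K).

Definition bop0 : 'L(H, K) := @BoundedOp C H K (\0 : H -> K) (@cst_continuous H K 0).

(* The unique bounded operator satisfying [P] (and a junk value if none does). *)
Definition the_op (P : set 'L(H, K)) : 'L(H, K) := xget bop0 P.

End bounded_op.

Lemma closure_normP (C : numClosedFieldType) (H : hilbertType C) (A : set H) x :
  closure A x <-> forall e, 0 < e -> exists2 y, A y & `|x - y| < e.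
Proof.
split=> [Ax e e0|Ax U /nbhs_ballP[e e0 xeU]].
  by have [y [Ay]] := Ax _ (nbhsx_ballx x e e0); rewrite -ball_normE; exists y.
have [y Ay xy] := Ax e e0; exists y; split => //.
by apply: xeU; rewrite -ball_normE.
Qed.

(* The closure of the range of [A], as a Hilbert space with the structure
   inherited from [K]. *)
Section range_closure.
Variables (C : numClosedFieldType) (H K : hilbertType C) (A : 'L(H, K)).

Definition in_range_closure : {pred K} := fun y => y \in closure (range A).

Let range_closure_submod : submod_closed in_range_closure.
Proof.
split; first by apply/mem_set/subset_closure; exists 0; rewrite // linear0.
move=> a x y /set_mem/closure_normP xA /set_mem/closure_normP yA.
apply/mem_set/closure_normP => e e0.
have a1 : 0 < `|a| + 1 by rewrite ltr_wpDl.
have d0 : 0 < e / 2 / (`|a| + 1) by rewrite !divr_gt0.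
have [_ [x' _ <-] xx'] := xA _ d0.
have [_ [y' _ <-] yy'] := yA _ (divr_gt0 e0 (ltr0Sn _ 1)).
exists (A (a *: x' + y')); first by exists (a *: x' + y').
rewrite linearP opprD addrACA -scalerBr (splitr e).
apply: le_lt_trans (ler_normD _ _) _; apply: ler_ltD yy'; rewrite normrZ.
apply: (@le_trans _ _ ((`|a| + 1) * `|x - A x'|)).
  by rewrite ler_wpM2r // lerDl.
by rewrite mulrC -ler_pdivlMr // ltW.
Qed.

HB.instance Definition _ :=
  GRing.isSubmodClosed.Build C K in_range_closure range_closure_submod.

Definition range_closure := {y : K | in_range_closure y}.

HB.instance Definition _ := SubChoice.on range_closure.
HB.instance Definition _ := [SubChoice_isSubLmodule of range_closure by <:].

Let range_closure_eq0 (x : range_closure) : `|val x| = 0 -> x = 0.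
Proof. by move=> /normr0_eq0 x0; apply: val_inj; rewrite x0 raddf0. Qed.

HB.instance Definition _ := Lmodule_isNormed.Build C range_closure
  (fun x y => ler_normD (val x) (val y))
  (fun a x => normrZ a (val x))
  range_closure_eq0.

Let range_closure_complete (F : set_system range_closure) :
  ProperFilter F -> cauchy F -> cvg F.
Proof.
move=> FF /cauchyP Fc.
have Fci : cauchy ((val : range_closure -> K) @ F).
  apply/cauchyP => e /Fc[x Fx]; exists (val x).
  suff : F [set y : range_closure | ball (val x) e (val y)] by [].
  by apply: filterS Fx => y; rewrite -!ball_normE.
have /cvgrPdist_lt Fl := @cauchy_cvg K _ (fmap_proper_filter _ FF) Fci.
have lA : in_range_closure (lim ((val : range_closure -> K) @ F)).
  apply/mem_set/closure_normP => e e0.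
  have e20 : 0 < e / 2 by rewrite divr_gt0.
  have [x lx] := @filter_ex _ _ FF _ (Fl _ e20).
  have /set_mem/closure_normP/(_ _ e20)[y Ay xy] := valP x.
  exists y => //; rewrite (splitr e).
  by rewrite -(subrK (val x) (lim _)) -addrA (le_lt_trans (ler_normD _ _))// ltrD.
apply/cvg_ex; exists (Sub _ lA); apply/cvgrPdist_lt => e e0.
exact: Fl.
Qed.

HB.instance Definition _ :=
  Uniform_isComplete.Build range_closure range_closure_complete.

Definition range_closure_inner (x y : range_closure) : C :=
  inner (val x) (val y).

HB.instance Definition _ := CompleteNormedModule_isHilbert.Build C range_closure
  (fun a x y z => inner_linearl a (val x) (val y) (val z))
  (fun x y => innerC (val x) (val y))
  (fun x => innerxx (val x)).

(* [A x], as an element of the closure of the range of [A]. *)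
Definition corestr (x : H) : range_closure :=
  exist _ (A x) (mem_set (subset_closure (imageT A x))).

End range_closure.

Section operators.
Variables (C : numClosedFieldType) (H K : hilbertType C).

Definition adj (A : H -> K) : 'L(K, H) :=
  the_op [set B : 'L(K, H) | forall x y, inner (A x) y = inner x (B y)].

Definition pos_sqrt (A : H -> H) : 'L(H, H) :=
  the_op [set B : 'L(H, H) | (forall x, 0 <= inner (B x) x) /\ B \o B =1 A].

Definition op_inv (A : H -> H) : 'L(H, H) :=
  the_op [set B : 'L(H, H) | cancel A B /\ cancel B A].

End operators.

Section defect.
Variables (C : numClosedFieldType) (H K : hilbertType C) (A : H -> K).

Definition defect : 'L(H, H) := pos_sqrt (fun x => x - adj A (A x)).

Definition defect_space : hilbertType C := range_closure defect.

Definition defect_incl (x : defect_space) : H := \val (x : range_closure defect).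

Definition defect_elt (x : H) : defect_space := corestr defect x.

End defect.

Definition unitary (C : numClosedFieldType) (H K : hilbertType C)
  (U : 'L(H, K)) : Prop := cancel U (adj U) /\ cancel (adj U) U.

Section unit_ball.
Variables (C : numClosedFieldType) (n : nat).
Implicit Types z w lam : 'rV[C]_n.

Definition vdot z w : C := \sum_i z 0 i * (w 0 i)^*.

Definition unit_ball : set 'rV[C]_n := [set z | vdot z z < 1].

(* Orthogonal projection onto the span of [lam]; it is 0 when [lam = 0]. *)
Definition vproj lam z : 'rV[C]_n := (vdot z lam / vdot lam lam) *: lam.

Definition vdefect lam : C := sqrtC (1 - vdot lam lam).

Definition phi lam z : 'rV[C]_n :=
  lam - (vdefect lam / (1 - vdot z lam)) *: (z - (1 - vdefect lam) *: vproj lam z).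

Definition coincide (E1 E2 E1' E2' : hilbertType C)
    (Th : 'rV[C]_n -> 'L(E1, E2)) (Th' : 'rV[C]_n -> 'L(E1', E2')) : Prop :=
  exists (U1 : 'L(E1, E1')) (U2 : 'L(E2, E2')),
    [/\ unitary U1, unitary U2 &
        forall z, unit_ball z -> forall x, U2 (Th z x) = Th' z (U1 x)].

End unit_ball.

Section multicontraction.
Variables (C : numClosedFieldType) (n : nat) (H : hilbertType C).
Implicit Types (T : 'I_n -> H -> H) (z lam : 'rV[C]_n).

Definition row_op T (h : hsum n H) : H := \sum_i T i (h i).

Definition scal_row z : hsum n H -> H := row_op (fun i x => z 0 i *: x).

Definition commuting_multicontraction (T : 'I_n -> 'L(H, H)) : Prop :=
  (forall i j x, T i (T j x) = T j (T i x)) /\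
  (forall x, inner (\sum_i T i (adj (T i) x)) x <= inner x x).

(* The formula is imposed after the inclusion of the target defect space in [H];
   its right-hand side lies in that space because [T D_T = D_{T^*} T]. *)
Definition theta T z : 'L(defect_space (row_op T), defect_space (adj (row_op T))) :=
  the_op [set Th | forall x : defect_space (row_op T),
    defect_incl (Th x) = - row_op T (defect_incl x)
      + defect (adj (row_op T))
          (op_inv (fun h => h - scal_row z (adj (row_op T) h))
            (scal_row z (defect (row_op T) (defect_incl x))))].

(* [phi lam] is a rational map with poles off the closed ball, so its analytic
   functional calculus at [T] substitutes [T] for [z]: [vdot z lam] becomes
   [phi_pairing lam T]. *)
Definition phi_pairing lam T (x : H) : H := \sum_i (lam 0 i)^* *: T i x.

Definition phi_tuple lam T (i : 'I_n) (x : H) : H :=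
  lam 0 i *: x - vdefect lam *:
    op_inv (fun y => y - phi_pairing lam T y)
      (T i x - (1 - vdefect lam) *:
        ((lam 0 i / vdot lam lam) *: phi_pairing lam T x)).

Definition Omega_spec lam T
    (Om : 'L(defect_space (row_op (phi_tuple lam T)), defect_space (row_op T))) :=
  forall x : hsum n H,
    Om (defect_elt (row_op (phi_tuple lam T)) x) =
    defect_elt (row_op T)
      (op_inv (fun h => h - adj (scal_row lam) (row_op T h))
        (defect (scal_row lam) x)).

Definition Omega_star_spec lam T
    (Oms : 'L(defect_space (adj (row_op (phi_tuple lam T))),
              defect_space (adj (row_op T)))) :=
  forall x : H,
    Oms (defect_elt (adj (row_op (phi_tuple lam T))) x) =
    defect_elt (adj (row_op T))
      (op_inv (fun h => h - scal_row lam (adj (row_op T) h))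
        (defect (adj (scal_row lam)) x)).

End multicontraction.

Arguments Omega_spec {C n H} lam T Om.
Arguments Omega_star_spec {C n H} lam T Oms.

(* Main.v *)
(* Write [l] for the row [lam], [s] and [D] for its two defect operators (the
   first is a scalar), and [Phi] for the row [phi_lam(T)]. With
   [y = (1 - l^* T)^-1 D x] one has [Phi x = l x - s T y] and [y = D x + l^* T y],
   so [(Phi x, y)] is the image of [(x, T y)] under the (isometric) Julia operator
   of [l]. Hence [|x|^2 - |Phi x|^2 = |y|^2 - |T y|^2]: [Phi] is a contraction and
   [D_Phi x |-> D_T y] is isometric; it is onto because [x |-> y] is. The adjoint of
   the Julia operator treats [Omega_*] in the same way.
   For the characteristic functions, [theta_T(z) D_T = D_{T^*} (1 - z T^* )^-1 (z - T)].
   With [w = phi_lam(z)] and [c = 1 - <z, lam>], the identities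
   [z - Phi = - (c / s) (w - T) (1 - l^* T)^-1 D] and
   [1 - z Phi^* = c (1 - w T^* ) (1 - l T^* )^-1]
   turn this formula for [Phi] at [z] into the one for [T] at [w], up to a sign:
   [Omega_* theta_Phi(z) = - theta_T(w) Omega] (for [lam = 0], [Phi = - T]), and
   [- Omega_*] is unitary too. *)

From HB Require Import structures.
Require Import Defs.
From mathcomp Require Import all_boot all_order all_algebra.
From mathcomp Require Import complex reals.
From mathcomp Require Import boolp classical_sets topology normedtype sequences.
From mathcomp Require Import ring lra.

Set Implicit Arguments.
Unset Strict Implicit.
Unset Printing Implicit Defensive.

Import Order.TTheory GRing.Theory Num.Theory.
Import numFieldNormedType.Exports.

Local Open Scope classical_set_scope.
Local Open Scope ring_scope.

(** * Inner products and bounded operators *)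

Section inner_product.
Variables (C : numClosedFieldType) (H : hilbertType C).
Implicit Types (x y z : H) (a : C).

Lemma innerDl x y z : inner (x + y) z = inner x z + inner y z.
Proof. by have := inner_linearl 1 x y z; rewrite scale1r mul1r. Qed.

Lemma inner0l z : inner (0 : H) z = 0.
Proof. by apply: (addrI (inner 0 z)); rewrite -innerDl !addr0. Qed.

Lemma innerZl a x z : inner (a *: x) z = a * inner x z.
Proof. by have := inner_linearl a x 0 z; rewrite addr0 inner0l addr0. Qed.

Lemma innerNl x z : inner (- x) z = - inner x z.
Proof. by rewrite -scaleN1r innerZl mulN1r. Qed.

Lemma innerBl x y z : inner (x - y) z = inner x z - inner y z.
Proof. by rewrite innerDl innerNl. Qed.

Lemma innerDr x y z : inner z (x + y) = inner z x + inner z y.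
Proof. by rewrite innerC innerDl rmorphD /= -!innerC. Qed.

Lemma inner0r z : inner z (0 : H) = 0.
Proof. by rewrite innerC inner0l rmorph0. Qed.

Lemma innerZr a x z : inner z (a *: x) = a^* * inner z x.
Proof. by rewrite innerC innerZl rmorphM /= -innerC. Qed.

Lemma innerNr x z : inner z (- x) = - inner z x.
Proof. by rewrite innerC innerNl rmorphN /= -innerC. Qed.

Lemma innerBr x y z : inner z (x - y) = inner z x - inner z y.
Proof. by rewrite innerDr innerNr. Qed.

Lemma inner_suml I r (P : pred I) (F : I -> H) z :
  inner (\sum_(i <- r | P i) F i) z = \sum_(i <- r | P i) inner (F i) z.
Proof.
by elim/big_rec2: _ => [|i y1 y2 _ <-]; rewrite ?inner0l ?innerDl.
Qed.

Lemma inner_inj x y : (forall z, inner x z = inner y z) -> x = y.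
Proof.
by move=> xy; apply/subr0_eq/inner_eq0; rewrite innerBl xy subrr.
Qed.

Lemma norm_inner_le x y : `|inner x y| <= `|x| * `|y|.
Proof.
rewrite -(@ler_pXn2r _ 2) ?nnegrE ?mulr_ge0 // exprMn -!innerxx.
apply: inner_CauchySchwarz => *; [exact: inner_linearl|exact: innerC|
  exact: inner_ge0|exact: inner_eq0].
Qed.

Lemma ler_norm_inner (c : C) x : 0 <= c -> `|x| ^+ 2 <= c * `|x| -> `|x| <= c.
Proof.
move=> c0; have [->|x0] := eqVneq x 0; first by rewrite normr0.
by rewrite expr2 ler_pM2r // normr_gt0.
Qed.

End inner_product.

Section polarization.
Variables (C : numClosedFieldType) (V : lmodType C) (F : V -> V -> C).
Hypothesis FDl : forall x y z, F (x + y) z = F x z + F y z.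
Hypothesis FZl : forall a x z, F (a *: x) z = a * F x z.
Hypothesis FDr : forall x y z, F z (x + y) = F z x + F z y.
Hypothesis FZr : forall a x z, F z (a *: x) = a^* * F z x.

(** Polarization: the diagonal at [x + y] gives [F x y = - F y x], and at [x + 'i *: y] it gives
    [F x y = F y x]. *)
Lemma sesquilinear_eq0 : (forall x, F x x = 0) -> forall x y, F x y = 0.
Proof.
move=> F0 x y.
have E1 : F x y + F y x = 0.
  by have := F0 (x + y); rewrite FDl !FDr !F0 add0r addr0.
have : F x ('i *: y) + F ('i *: y) x = 0.
  by have := F0 (x + 'i *: y); rewrite FDl !FDr !F0 add0r addr0.
rewrite FZl FZr conjCi mulNr addrC -mulrBr => /eqP.
rewrite mulf_eq0 (negPf (neq0Ci _)) subr_eq0 => /eqP E2.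
by move: E1; rewrite E2 -mulr2n => /eqP; rewrite mulrn_eq0 => /eqP.
Qed.

End polarization.

Section bounded_operators.
Variable C : numClosedFieldType.
Implicit Types H K L : hilbertType C.

(** A predicate on plain functions, since [adj], [defect] and [op_inv] take such functions;
    destructing it replaces the function by a bundled operator. *)
Definition bounded_operator H K (f : H -> K) := exists B : 'L(H, K), f = B.

Lemma bounded_operator_bop H K (B : 'L(H, K)) : bounded_operator B.
Proof. by exists B. Qed.

Lemma bounded_operatorI H K (f : H -> K) (M : C) : linear f ->
  (forall x, `|f x| <= M * `|x|) -> bounded_operator f.
Proof.
move=> fl fM.
pose g : {linear H -> K} := HB.pack f (GRing.isLinear.Build C H K *:%R f fl).
have gc : continuous g.
  apply/linear_bounded_continuous/bounded_funP => r; exists (`|M| * `|r|) => x xr.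
  have := fM x; have [->|x0] := eqVneq x 0.
    by move=> _; rewrite [g 0]linear0 normr0 mulr_ge0.
  (* The sign of [M] comes from the bound itself at a nonzero vector. *)
  move=> fMx; have M0 : 0 <= M.
    by rewrite -(pmulr_lge0 _ (_ : 0 < `|x|)) ?normr_gt0 // (le_trans _ fMx).
  rewrite (le_trans fMx) // ger0_norm // ler_wpM2l //.
  by rewrite (le_trans xr) // real_ler_norm // ger0_real // (le_trans _ xr).
by exists (BoundedOp gc).
Qed.

Lemma bop_bounded H K (B : 'L(H, K)) :
  exists2 M : C, 0 < M & forall x, `|B x| <= M * `|x|.
Proof.
have := @bop_continuous _ _ _ B => /linear_bounded_continuous/linear_boundedP.
by move/pinfty_ex_gt0 => [M M0 BM]; exists M.
Qed.

Lemma bounded_operator_id H : bounded_operator (@id H).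
Proof. by apply: (@bounded_operatorI _ _ _ 1) => // x; rewrite mul1r. Qed.

Lemma bounded_operator_comp H K L (g : K -> L) (f : H -> K) :
  bounded_operator g -> bounded_operator f -> bounded_operator (fun x => g (f x)).
Proof.
move=> [G ->] [F ->].
have [M M0 GM] := bop_bounded G; have [N N0 FN] := bop_bounded F.
apply: (@bounded_operatorI _ _ _ (M * N)) => [a x y|x]; first by rewrite !linearP.
by rewrite (le_trans (GM _))// -mulrA ler_wpM2l // ltW.
Qed.

Lemma bounded_operatorD H K (f g : H -> K) :
  bounded_operator f -> bounded_operator g -> bounded_operator (fun x => f x + g x).
Proof.
move=> [F ->] [G ->].
have [M M0 FM] := bop_bounded F; have [N N0 GN] := bop_bounded G.
apply: (@bounded_operatorI _ _ _ (M + N)) => [a x y|x].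
  by rewrite !linearP scalerDr addrACA.
by rewrite (le_trans (ler_normD _ _)) // mulrDl lerD.
Qed.

Lemma bounded_operatorZ H K (a : C) (f : H -> K) :
  bounded_operator f -> bounded_operator (fun x => a *: f x).
Proof.
move=> [F ->]; have [M M0 FM] := bop_bounded F.
apply: (@bounded_operatorI _ _ _ (`|a| * M)) => [b x y|x].
  by rewrite linearP scalerDr !scalerA mulrC.
by rewrite normrZ -mulrA ler_wpM2l.
Qed.

Lemma bounded_operatorN H K (f : H -> K) :
  bounded_operator f -> bounded_operator (fun x => - f x).
Proof.
move=> /(bounded_operatorZ (-1)).
by under eq_fun do rewrite scaleN1r.
Qed.

Lemma bounded_operatorB H K (f g : H -> K) :
  bounded_operator f -> bounded_operator g -> bounded_operator (fun x => f x - g x).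
Proof. by move=> fb gb; apply: bounded_operatorD fb (bounded_operatorN gb). Qed.

Lemma bounded_operator_sum H K n (f : 'I_n -> H -> K) :
  (forall i, bounded_operator (f i)) -> bounded_operator (fun x => \sum_i f i x).
Proof.
elim: n f => [|n IH] f fb.
  apply: (@bounded_operatorI _ _ _ 0) => [a x y|x]; rewrite !big_ord0 ?normr0 ?mul0r //.
  by rewrite scaler0 addr0.
under eq_fun do rewrite big_ord_recl.
by apply: bounded_operatorD => //; apply: IH => i.
Qed.

End bounded_operators.

(** * Riesz representation and adjoints *)

Section complex_hilbert.
Variable R : realType.
Local Notation C := R[i].
Local Notation "x %:C" := (real_complex R x) : ring_scope.

(** Comparable complex numbers have equal imaginary parts, so a positive one is real. *)
Lemma gtc0_real (e : C) : 0 < e -> exists2 r : R, 0 < r & e = r%:C.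
Proof.
move=> e0; exists (complex.Re e); last by rewrite RRe_real // gtr0_real.
by move: e0; rewrite ltcE => /andP[].
Qed.

(* The norm is [R[i]]-valued; limits and infima are taken on its real version. *)
Definition nrm (H : normedModType C) (x : H) : R := complex.Re `|x|.

Lemma nrmE (H : normedModType C) (x : H) : `|x| = (nrm x)%:C.
Proof. by rewrite RRe_real // ger0_real. Qed.

Lemma nrm_ge0 (H : normedModType C) (x : H) : 0 <= nrm x.
Proof. by rewrite -ler0c -nrmE. Qed.

Lemma cauchy_seq_cvg (H : completeNormedModType C) (x : nat -> H) :
  (forall e : R, 0 < e -> exists N, forall n, (N <= n)%N -> `|x N - x n| < e%:C) ->
  exists l : H, x @ \oo --> l.
Proof.
move=> xc; apply/cvg_ex; apply: (@cauchy_cvg H (x @ \oo)).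
apply/cauchyP => _ /gtc0_real[e e0 ->].
have [N xN] := xc e e0; exists (x N); exists N => // n /= Nn.
by rewrite -ball_normE; exact: xN.
Qed.

Lemma cvg_seqP (H : normedModType C) (x : nat -> H) (l : H) :
  x @ \oo --> l <->
  forall e : R, 0 < e -> exists N, forall n, (N <= n)%N -> `|l - x n| < e%:C.
Proof.
split=> [/cvgrPdist_lt xl e e0|xl].
  have [|N _ NP] := xl e%:C; first by rewrite ltcR.
  by exists N => n Nn; exact: NP.
apply/cvgrPdist_lt => _ /gtc0_real[e e0 ->].
by have [N NP] := xl e e0; exists N => // n; exact: NP.
Qed.

Lemma cvg_seq_unique (H : normedModType C) (x : nat -> H) (l m : H) :
  x @ \oo --> l -> x @ \oo --> m -> l = m.
Proof. exact: cvg_unique. Qed.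

Lemma cvg_norm_le (H : normedModType C) (x : nat -> H) (l : H) (M : R) :
  x @ \oo --> l -> (forall n, `|x n| <= M%:C) -> `|l| <= M%:C.
Proof.
move=> /cvg_seqP xl xM; rewrite nrmE lecR; apply/ler_addgt0Pr => e e0.
have [N /(_ N (leqnn N)) lN] := xl e e0.
rewrite -lecR -nrmE rmorphD /= -(subrK (x N) l) addrC.
by rewrite (le_trans (ler_normD _ _)) // lerD // ltW.
Qed.

(** The bounds on the increments make [a] nondecreasing; being bounded it is Cauchy, and [x]
    inherits this by telescoping. *)
Lemma dominated_seq_cvg (H : completeNormedModType C) (x : nat -> H) (a : R ^nat)
    (M : R) :
  (forall n, a n <= M) -> (forall n, `|x n.+1 - x n| <= (a n.+1 - a n)%:C) ->
  exists l : H, x @ \oo --> l.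
Proof.
move=> aM xa.
have a_nd : nondecreasing_seq a.
  apply/nondecreasing_seqP => n; rewrite -subr_ge0 -lecR.
  exact: le_trans (normr_ge0 _) (xa n).
have xab N n : (N <= n)%N -> `|x N - x n| <= (a n - a N)%:C.
  elim: n => [|n IH]; first by rewrite leqn0 => /eqP ->; rewrite !subrr normr0.
  rewrite leq_eqVlt => /orP[/eqP <-|]; first by rewrite !subrr normr0.
  rewrite ltnS => /IH {}IH.
  have -> : a n.+1 - a N = (a n - a N) + (a n.+1 - a n) by ring.
  rewrite rmorphD /= -(subrKA (x n)) (le_trans (ler_normD _ _)) // lerD //.
  by rewrite distrC.
have : cvgn a by apply: nondecreasing_is_cvgn => //; exists M => _ [n _ <-].
move=> /cvg_ex[l /cvgrPdist_lt al]; apply: cauchy_seq_cvg => e e0.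
have [N _ NP] := al _ (divr_gt0 e0 (ltr0Sn R 1)); exists N => n Nn.
apply: le_lt_trans (xab _ _ Nn) _; rewrite ltcR.
have := NP N (leqnn N); have := NP n Nn; rewrite /= !ltr_norml; lra.
Qed.

Section riesz.
Variables (H : hilbertType C) (f : H -> C) (M : R).
Hypothesis fD : forall x y, f (x + y) = f x + f y.
Hypothesis fZ : forall a x, f (a *: x) = a * f x.
Hypothesis fM : forall x, `|f x| <= M%:C * `|x|.

Local Notation Re := (@complex.Re R).

Let Re_le (z : C) : `|Re z|%:C <= `|z|.
Proof. by rewrite normc_def lecR -sqrtr_sqr ler_wsqrtr // lerDl sqr_ge0. Qed.

Let nrm2 (x : H) : Re (inner x x) = nrm x ^+ 2.
Proof. by rewrite innerxx nrmE -rmorphXn. Qed.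

Let ReD (x y : C) : Re (x + y) = Re x + Re y.
Proof. by case: x; case: y. Qed.

Let ReN (x : C) : Re (- x) = - Re x.
Proof. by case: x. Qed.

Let ReZ (t : R) (x : C) : Re (t%:C * x) = t * Re x.
Proof. by case: x => a b /=; rewrite mul0r subr0. Qed.

Let ReC (x : C) : Re x^* = Re x.
Proof. by case: x. Qed.

(* The representing vector minimises [J]. *)
Let J (x : H) : R := nrm x ^+ 2 - 2 * Re (f x).

(** Completing the square in [nrm x ^+ 2 - 2 * M * nrm x]. *)
Let J_ge x : - M ^+ 2 <= J x.
Proof.
have : Re (f x) <= M * nrm x.
  rewrite (le_trans (ler_norm _)) // -lecR (le_trans (Re_le _)) //.
  by rewrite rmorphM /= -nrmE.
by move=> h; have := sqr_ge0 (nrm x - M); rewrite /J; nra.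
Qed.

Let JD x y (t : R) :
  J (x + t%:C *: y) = J x + t ^+ 2 * nrm y ^+ 2 + 2 * t * (Re (inner x y) - Re (f y)).
Proof.
rewrite /J -!nrm2 fD fZ innerDl !innerDr !innerZl !innerZr [inner y x]innerC.
have -> : t%:C^* = t%:C :> C by exact: conjc_real.
rewrite !ReD !ReZ ReC; ring.
Qed.

(** Parallelogram law, in which the terms in [f] balance; it makes minimising sequences Cauchy. *)
Let J_dist x y :
  nrm (x - y) ^+ 2 + 4 * J ((2^-1)%:C *: (x + y)) = 2 * J x + 2 * J y.
Proof.
rewrite /J -!nrm2 fZ fD innerBl !innerBr innerZl innerZr innerDl !innerDr.
rewrite (_ : ((2^-1)%:C)^* = (2^-1)%:C :> C); last exact: conjc_real.
rewrite !(ReZ, ReN, ReD); lra.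
Qed.

(** A minimising sequence of [J] converges to some [y]. The first variation there gives
    [Re (f z) = Re (inner z y)], and replacing [z] by ['i *: z] recovers the imaginary part. *)
Lemma riesz : exists y, forall x, f x = inner x y.
Proof.
pose m := inf (range J).
have J_inf : has_inf (range J).
  by split; [exists (J 0), 0 | exists (- M ^+ 2) => _ [x _ <-]].
have mJ x : m <= J x by apply: ge_inf; [case: J_inf | exists x].
have /choice[x xm] n : exists x, J x < m + n.+1%:R^-1.
  have n0 : (0 : R) < n.+1%:R^-1 by rewrite invr_gt0 ltr0Sn.
  have [_ [x _ <-] xm] := inf_adherent n0 J_inf.
  by exists x.
have invn_lt (e : R) : 0 < e -> exists N, forall n, (N <= n)%N -> n.+1%:R^-1 < e.
  move=> e0.
  have /cvgrPdist_lt/(_ e e0)[N _ NP] := @cvg_harmonic R.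
  exists N => n /NP; by rewrite /= sub0r normrN ger0_norm ?invr_ge0.
have [y xy] : exists y : H, x @ \oo --> y.
  apply: cauchy_seq_cvg => e e0.
  (* By [J_dist] the squared distance is below twice the sum of two errors, each less than
     [e ^+ 2 / 4]. *)
  have [|N NP] := invn_lt (e ^+ 2 / 4); first by rewrite divr_gt0 // exprn_gt0.
  exists N => n Nn.
  rewrite nrmE ltcR -(@ltr_pXn2r _ 2) ?nnegrE ?nrm_ge0 //; last exact: ltW.
  have := J_dist (x N) (x n); have := mJ ((2^-1)%:C *: (x N + x n)).
  have := NP N (leqnn N); have := NP n Nn; have := xm N; have := xm n.
  move: (n.+1%:R^-1) (N.+1%:R^-1) => a b; lra.
have Re_eq z : Re (f z) = Re (inner z y).
  set d := Re (inner y z) - Re (f z).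
  suff d0 : d = 0.
    by rewrite [inner z y]innerC ReC; apply/eqP; rewrite eq_sym -subr_eq0 -/d d0.
  (* This is minimality of [J] at [y], expanded. It is read off an approximant [w], losing [e / 2]
     for [J w] being only near [m] and [e / 2] for [w] being only near [y]. *)
  have Jt t : 0 <= t ^+ 2 * nrm z ^+ 2 + 2 * t * d.
    apply/ler_addgt0Pr => e e0.
    have e20 : 0 < e / 2 by rewrite divr_gt0.
    pose e' := e / 2 / (2 * `|t| * nrm z + 1).
    have k0 : 0 < 2 * `|t| * nrm z + 1 by rewrite ltr_wpDl // !mulr_ge0 // nrm_ge0.
    have [N1 /(_ _ (leq_maxl N1 _)) N1P] := invn_lt _ e20.
    have /cvg_seqP/(_ _ (divr_gt0 e20 k0))[N2 N2P] := xy.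
    have {N2P} := N2P (maxn N1 N2) (leq_maxr _ _).
    move: (N1P N2) (xm (maxn N1 N2)) (mJ (x (maxn N1 N2) + t%:C *: z)).
    rewrite JD; set w := x _ => h1 h2 h3; rewrite nrmE ltcR => h4.
    have h5 : `|Re (inner y z) - Re (inner w z)| <= nrm (y - w) * nrm z.
      rewrite -ReN -ReD -innerBl -lecR (le_trans (Re_le _)) //.
      rewrite rmorphM /= -!nrmE. exact: norm_inner_le.
    have h6 : 2 * `|t| * nrm z * nrm (y - w) <= e / 2.
      rewrite (@le_trans _ _ ((2 * `|t| * nrm z + 1) * nrm (y - w))) //.
        by rewrite ler_wpM2r ?nrm_ge0 // lerDl.
      by rewrite mulrC -ler_pdivlMr // ltW.
    have h7 : 2 * t * (Re (inner w z) - Re (inner y z)) <= e / 2.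
      apply: le_trans h6; rewrite (le_trans (ler_norm _)) // !normrM distrC.
      rewrite [`|2|]ger0_norm // -[leRHS]mulrA [nrm z * _]mulrC ler_wpM2l //.
      by rewrite mulr_ge0.
    move: h1 h2 h3 h7; rewrite /d.
    by move: (_.+1%:R^-1) (J w) => a b; lra.
  (* A near-optimal [t], with [+ 1] keeping the denominator positive; the quadratic becomes negative
     unless [d = 0]. *)
  have := Jt (- d / (nrm z ^+ 2 + 1)).
  have z1 : 0 < nrm z ^+ 2 + 1 by rewrite ltr_wpDl // sqr_ge0.
  set u := nrm z ^+ 2 in z1 *.
  have -> : (- d / (u + 1)) ^+ 2 * u + 2 * (- d / (u + 1)) * d
      = - (d / (u + 1)) ^+ 2 * (u + 2) by field; lra.
  have u2 : 0 < u + 2 by lra.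
  rewrite pmulr_lge0 // oppr_ge0 => d2.
  have /eqP : (d / (u + 1)) ^+ 2 = 0 by apply/eqP; rewrite eq_le d2 sqr_ge0.
  by rewrite sqrf_eq0 mulf_eq0 invr_eq0 (gt_eqF z1) orbF => /eqP.
exists y => x0; apply/eqP; rewrite eq_complex Re_eq eqxx /=; apply/eqP.
have := Re_eq ('i%C *: x0); rewrite fZ innerZl ![('i%C * _)]mulrC !ReiNIm.
exact: oppr_inj.
Qed.

End riesz.

(** Riesz represents [x |-> inner (A x) y] by [B y]; the bound on [B] follows from [|B y|^2 = inner
    (A (B y)) y <= M |B y| |y|]. *)
Lemma adjoint_exists (H K : hilbertType C) (A : H -> K) : bounded_operator A ->
  exists B : 'L(K, H), forall x y, inner (A x) y = inner x (B y).
Proof.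
move=> [{}A ->]; have [_ /gtc0_real[M M0 ->] AM] := bop_bounded A.
have /choice[B BP] y : exists z, forall x, inner (A x) y = inner x z.
  apply: (@riesz _ (fun x => inner (A x) y) (M * nrm y)) => [x z|a x|x].
  - by rewrite linearD innerDl.
  - by rewrite linearZ innerZl.
  - rewrite rmorphM /= -nrmE mulrAC (le_trans (norm_inner_le _ _)) //.
    by rewrite ler_wpM2r.
have [] := @bounded_operatorI _ _ _ B M%:C.
- move=> a y z; apply: inner_inj => x; rewrite [LHS]innerC -BP.
  by rewrite innerDr innerZr !BP -innerZr -innerDr -innerC.
- move=> y; have [->|By] := eqVneq (B y) 0.
    by rewrite normr0 mulr_ge0 // ler0c ltW.
  have By0 : 0 < `|B y| by rewrite normr_gt0.
  rewrite -(ler_pM2r By0) -expr2 -innerxx -(ger0_norm (inner_ge0 _)) -BP.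
  by rewrite (le_trans (norm_inner_le _ _)) // mulrAC ler_wpM2r.
- by move=> B' BB'; exists B' => x y; rewrite -BB' BP.
Qed.

End complex_hilbert.

(** * Specifications of adjoints and inverses; the Neumann series *)

Section functional_calculus.
Variable R : realType.
Local Notation C := R[i].
Local Notation "x %:C" := (real_complex R x) : ring_scope.

(** One witness suffices for the chosen operator to meet its specification; every notion built on
    [the_op] is accessed in this way. *)
Lemma the_opP (H K : hilbertType C) (P : set 'L(H, K)) B : P B -> P (the_op P).
Proof. exact: xgetI. Qed.

Section adjoint.
Variables (H K : hilbertType C) (A : H -> K).
Hypothesis Ab : bounded_operator A.

Lemma adjE x y : inner (A x) y = inner x (adj A y).
Proof.
move: x y; have [B BA] := adjoint_exists Ab.
exact: (the_opP (P := [set B : 'L(K, H) | forall x y, inner (A x) y = inner x (B y)])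
  BA).
Qed.

Lemma adjEr x y : inner (adj A y) x = inner y (A x).
Proof. by rewrite innerC -adjE -innerC. Qed.

Lemma adj_unique (B : K -> H) :
  (forall x y, inner (A x) y = inner x (B y)) -> adj A =1 B.
Proof.
move=> BA y; apply: inner_inj => x.
by rewrite [LHS]innerC [RHS]innerC -adjE BA.
Qed.

Lemma adj_norm_le : (forall x, `|A x| <= `|x|) -> forall y, `|adj A y| <= `|y|.
Proof.
move=> A1 y; apply: ler_norm_inner => //.
rewrite -innerxx -(ger0_norm (inner_ge0 _)) -adjE mulrC.
by rewrite (le_trans (norm_inner_le _ _)) // ler_wpM2r.
Qed.

End adjoint.

Lemma adjK (H K : hilbertType C) (A : H -> K) :
  bounded_operator A -> adj (adj A) =1 A.
Proof.
move=> Ab; apply: adj_unique; first exact: bounded_operator_bop.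
by move=> x y; exact: adjEr.
Qed.

Lemma op_invP (H : hilbertType C) (A B : H -> H) : bounded_operator B ->
  cancel A B -> cancel B A -> cancel A (op_inv A) /\ cancel (op_inv A) A.
Proof.
move=> [{}B ->] AB BA.
exact: (the_opP (P := [set B : 'L(H, H) | cancel A B /\ cancel B A])
  (conj AB BA)).
Qed.

Lemma cvg_bop (H K : hilbertType C) (A : 'L(H, K)) (x : nat -> H) (l : H) :
  x @ \oo --> l -> (fun n => A (x n)) @ \oo --> A l.
Proof. by move=> xl; apply: continuous_cvg => //; apply: bop_continuous. Qed.

(** Neumann series: the iterates [z |-> h + A z] from 0 are its partial sums. The estimate
    [(1 - q) |x| <= |x - A x|] gives injectivity and the bound on the inverse. *)
Lemma one_sub_invertible (H : hilbertType C) (A : H -> H) (q : R) :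
  bounded_operator A -> 0 <= q < 1 -> (forall x, `|A x| <= q%:C * `|x|) ->
  exists B : 'L(H, H), cancel (fun x => x - A x) B /\ cancel B (fun x => x - A x).
Proof.
move=> [{}A ->] /andP[q0 q1] Aq.
have q1' : 0 < 1 - q by rewrite subr_gt0.
have bound x : `|x| <= ((1 - q)^-1)%:C * `|x - A x|.
  rewrite nrmE (nrmE (x - _)) -rmorphM lecR ler_pdivlMl // -lecR.
  rewrite rmorphM /= -!nrmE rmorphB rmorph1 mulrBl mul1r lerBlDr.
  by rewrite -{1}(subrK (A x) x) (le_trans (ler_normD _ _)) // lerD2l.
have inj x y : x - A x = y - A y -> x = y.
  move=> xy; apply/subr0_eq/normr0_eq0/eqP; rewrite eq_le normr_ge0 andbT.
  rewrite (le_trans (bound _)) // linearB opprD addrACA -opprD.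
  by rewrite xy subrr normr0 mulr0.
have ex h : exists z, z - A z = h.
  pose z n := iter n (fun z => h + A z) 0.
  have dz n : `|z n.+1 - z n| <= (q ^+ n * nrm h)%:C.
    elim: n => [|n IH].
      by rewrite /z /= linear0 addr0 subr0 expr0 mul1r -nrmE.
    rewrite /z /= -/(z n.+1) -/(z n) opprD addrACA subrr add0r -linearB.
    rewrite (le_trans (Aq _)) // exprS -mulrA rmorphM /= ler_wpM2l //.
    by rewrite ler0c.
  have [l zl] : exists l : H, z @ \oo --> l.
    (* The majorant is the sequence of partial sums of the geometric series with terms
       [q ^+ n * nrm h]. *)
    apply: (@dominated_seq_cvg _ _ _ (fun n => nrm h * (1 - q ^+ n) / (1 - q))
      (nrm h / (1 - q))) => n.
      rewrite ler_pM2r ?invr_gt0 // ler_piMr ?nrm_ge0 // gerBl exprn_ge0 //.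
    rewrite (le_trans (dz n)) // lecR -mulrBl -mulrBr.
    rewrite (_ : 1 - q ^+ n.+1 - (1 - q ^+ n) = q ^+ n * (1 - q)).
      by rewrite mulrA mulfK ?gt_eqF // mulrC.
    by rewrite exprS; ring.
  exists l; apply/eqP; rewrite subr_eq; apply/eqP.
  apply: (@cvg_seq_unique _ _ (fun n => z n.+1)); first by rewrite (cvg_shiftS z).
  by apply: cvgD; [exact: cvg_cst | exact: cvg_bop].
have /choice[B BP] := ex.
have [] := @bounded_operatorI _ _ _ B ((1 - q)^-1)%:C.
- move=> a x y; apply: inj; rewrite BP linearP opprD addrACA -scalerBr !BP //.
- by move=> x; rewrite -[in leRHS](BP x).
- by move=> B' BB'; exists B'; rewrite -BB'; split => x //=; exact: inj.
Qed.

End functional_calculus.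

(** * Positive square roots and defect operators *)

Section square_root.
Variable R : realType.
Local Notation C := R[i].
Local Notation "x %:C" := (real_complex R x) : ring_scope.

(* [Y |-> (A + Y^2) / 2] converges to [Y = 1 - sqrt (1 - A)] for a self-adjoint
   contraction [A]. *)
Fixpoint sqrt_seq (H : hilbertType C) (A : H -> H) (n : nat) (x : H) : H :=
  if n is m.+1 then (2^-1)%:C *: (A x + sqrt_seq A m (sqrt_seq A m x)) else 0.

(* The scalar case [A = 1]: it dominates the norms of the iterates and of their
   increments, and being bounded by 1 it forces pointwise convergence. *)
Fixpoint sqrt_majorant (n : nat) : R :=
  if n is m.+1 then (1 + sqrt_majorant m ^+ 2) / 2 else 0.

Lemma sqrt_majorant_itv n : 0 <= sqrt_majorant n <= 1.
Proof.
elim: n => [|n /andP[]] /=; first by rewrite lexx ler01.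
by move: (sqrt_majorant n) => y y0 y1; apply/andP; split; nra.
Qed.

Lemma sqrt_seq_bounded (H : hilbertType C) (A : H -> H) n :
  bounded_operator A -> bounded_operator (sqrt_seq A n).
Proof.
move=> Ab; elim: n => [|n IH] /=.
  by apply: (@bounded_operatorI _ _ _ _ 0) => [a x y|x];
    rewrite ?scaler0 ?addr0 // normr0 mul0r.
apply: bounded_operatorZ; apply: bounded_operatorD => //.
exact: (bounded_operator_comp IH IH).
Qed.

(** Each iterate is a polynomial in its operator, the same polynomial for [A] and for [B]. *)
Lemma sqrt_seq_intertwine (H K : hilbertType C) (A : H -> H) (B : K -> K)
    (T : 'L(H, K)) n :
  (forall x, T (A x) = B (T x)) -> forall x, T (sqrt_seq A n x) = sqrt_seq B n (T x).
Proof.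
move=> TAB; elim: n => [|n IH] x /=; first by rewrite linear0.
by rewrite linearZ linearD TAB !IH.
Qed.

Section contraction.
Variables (H : hilbertType C) (A : H -> H).
Hypothesis Ab : bounded_operator A.
Hypothesis A1 : forall x, `|A x| <= `|x|.

Lemma sqrt_seq_norm_le n x : `|sqrt_seq A n x| <= (sqrt_majorant n)%:C * `|x|.
Proof.
elim: n x => [|n IH] x /=; first by rewrite normr0 mul0r.
have /andP[y0 _] := sqrt_majorant_itv n.
rewrite normrZ ger0_norm ?ler0c ?invr_ge0 // mulrC rmorphM /= mulrAC.
rewrite ler_wpM2r ?ler0c ?invr_ge0 // (le_trans (ler_normD _ _)) //.
rewrite rmorphD rmorph1 mulrDl mul1r lerD // (le_trans (IH _)) //.
by rewrite rmorphXn expr2 -mulrA ler_wpM2l ?ler0c.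
Qed.

Lemma sqrt_seq_contraction n x : `|sqrt_seq A n x| <= `|x|.
Proof.
rewrite (le_trans (sqrt_seq_norm_le _ _)) // ler_piMl // -(rmorph1 (real_complex R)).
by rewrite lecR; case/andP: (sqrt_majorant_itv n).
Qed.

(** With [Y] and [Y'] consecutive iterates, [Y'^2 - Y^2 = Y' (Y' - Y) + (Y' - Y) Y]; the scalar
    majorants satisfy the same identity, so the bound propagates. *)
Lemma sqrt_seq_diff_le n x : `|sqrt_seq A n.+1 x - sqrt_seq A n x|
  <= (sqrt_majorant n.+1 - sqrt_majorant n)%:C * `|x|.
Proof.
elim: n x => [|n IH] x.
  rewrite /= addr0 !subr0 expr0n /= addr0 mul1r normrZ.
  by rewrite ger0_norm ?ler_wpM2l // ler0c invr_ge0.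
have [Y Y_eq] := sqrt_seq_bounded n.+1 Ab.
have -> : sqrt_seq A n.+2 x - sqrt_seq A n.+1 x = (2^-1)%:C *:
    (sqrt_seq A n.+1 (sqrt_seq A n.+1 x - sqrt_seq A n x)
     + (sqrt_seq A n.+1 (sqrt_seq A n x) - sqrt_seq A n (sqrt_seq A n x))).
  rewrite [LHS](_ : _ = (2^-1)%:C *: (A x + sqrt_seq A n.+1 (sqrt_seq A n.+1 x))
    - (2^-1)%:C *: (A x + sqrt_seq A n (sqrt_seq A n x))) //.
  rewrite -scalerBr opprD addrACA subrr add0r; congr (_ *: _).
  by rewrite Y_eq linearB subrKA.
have /andP[y0 _] := sqrt_majorant_itv n; have /andP[y1 _] := sqrt_majorant_itv n.+1.
have d0 : 0 <= (sqrt_majorant n.+1 - sqrt_majorant n)%:C.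
  rewrite ler0c (_ : _ - _ = (1 - sqrt_majorant n) ^+ 2 / 2) /=; last by field.
  by rewrite divr_ge0 // sqr_ge0.
rewrite normrZ ger0_norm ?ler0c ?invr_ge0 //.
rewrite (_ : sqrt_majorant n.+2 - sqrt_majorant n.+1 = 2^-1 *
   (sqrt_majorant n.+1 * (sqrt_majorant n.+1 - sqrt_majorant n)
   + (sqrt_majorant n.+1 - sqrt_majorant n) * sqrt_majorant n)); last first.
  by rewrite /=; field.
rewrite [in leRHS]rmorphM -mulrA ler_wpM2l ?ler0c ?invr_ge0 //.
rewrite (le_trans (ler_normD _ _)) // rmorphD mulrDl lerD // rmorphM -mulrA.
  by rewrite (le_trans (sqrt_seq_norm_le _ _)) // ler_wpM2l ?ler0c.
by rewrite (le_trans (IH _)) // ler_wpM2l ?sqrt_seq_norm_le.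
Qed.

(* The positive square root of [1 - A], not of [A]. *)
Definition contr_sqrt x : H := x - lim (sqrt_seq A ^~ x @ \oo).

Lemma sqrt_seq_cvg x : sqrt_seq A ^~ x @ \oo --> x - contr_sqrt x.
Proof.
rewrite /contr_sqrt subKr.
have [l xl] : exists l : H, sqrt_seq A ^~ x @ \oo --> l.
  apply: (@dominated_seq_cvg _ _ _ (fun n => sqrt_majorant n * nrm x) (nrm x)) => n.
    by rewrite ler_piMl ?nrm_ge0 //; case/andP: (sqrt_majorant_itv n).
  by rewrite (le_trans (sqrt_seq_diff_le _ _)) // -mulrBl rmorphM /= -nrmE.
exact: cvgP xl.
Qed.

End contraction.
End square_root.

Section positive_square_root.
Variable R : realType.
Local Notation C := R[i].
Local Notation "x %:C" := (real_complex R x) : ring_scope.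

Lemma cvg_inner_eq (H K : hilbertType C) (x : nat -> H) (y : nat -> K) l m u v :
  x @ \oo --> l -> y @ \oo --> m -> (forall n, inner (x n) u = inner v (y n)) ->
  inner l u = inner v m.
Proof.
move=> xl ym xy; apply/subr0_eq/normr0_eq0/eqP; rewrite eq_le normr_ge0 andbT.
set d := `|_|; have d_real : d \is Num.real := normr_real _.
have k0 : 0 < nrm u + nrm v + 1 by rewrite ltr_wpDl // addr_ge0 ?nrm_ge0.
rewrite -(RRe_real d_real) -(rmorph0 (real_complex R)) lecR; apply/ler_addgt0Pr => e e0.
have [N1 /(_ _ (leq_maxl N1 _)) N1P] := (cvg_seqP _ _).1 xl _ (divr_gt0 e0 k0).
have [N2 /(_ _ (leq_maxr _ N2)) N2P] := (cvg_seqP _ _).1 ym _ (divr_gt0 e0 k0).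
move: (N1P N2) (N2P N1); set n := maxn N1 N2 => {N1P N2P} h1 h2.
rewrite add0r -lecR RRe_real //.
have -> : d = `|inner (l - x n) u + inner v (y n - m)|.
  by rewrite innerBl innerBr xy addrA subrK.
rewrite (le_trans (ler_normD _ _)) //.
apply: (@le_trans _ _ ((e / (nrm u + nrm v + 1))%:C * (`|u| + `|v|))).
  rewrite mulrDr lerD // (le_trans (norm_inner_le _ _)) //.
    by rewrite ler_wpM2r // ltW.
  by rewrite mulrC ler_wpM2r // distrC ltW.
rewrite !nrmE -rmorphD -rmorphM lecR mulrAC ler_pdivrMr // ler_wpM2l ?ltW //.
by rewrite ltrDl.
Qed.

(** The iterates are intertwined, and the relation passes to the limit by continuity of [T]. *)
Lemma contr_sqrt_intertwine (H K : hilbertType C) (A : H -> H) (B : K -> K)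
    (T : H -> K) :
  bounded_operator A -> (forall x, `|A x| <= `|x|) ->
  bounded_operator B -> (forall x, `|B x| <= `|x|) ->
  bounded_operator T -> (forall x, T (A x) = B (T x)) ->
  forall x, T (contr_sqrt A x) = contr_sqrt B (T x).
Proof.
move=> Ab A1 Bb B1 [{}T ->] TAB x.
have TL : T (x - contr_sqrt A x) = T x - contr_sqrt B (T x).
  apply: (@cvg_seq_unique _ _ (fun n => T (sqrt_seq A n x))).
    exact: (@cvg_bop _ _ _ T _ _ (@sqrt_seq_cvg _ _ _ Ab A1 x)).
  under eq_fun do rewrite (sqrt_seq_intertwine _ TAB).
  exact: sqrt_seq_cvg.
by rewrite linearB in TL; exact/oppr_inj/(addrI (T x)).
Qed.

Section contraction.
Variables (H : hilbertType C) (A : H -> H).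
Hypothesis Ab : bounded_operator A.
Hypothesis A1 : forall x, `|A x| <= `|x|.
Hypothesis A_sym : forall x y, inner (A x) y = inner x (A y).

Let L x := x - contr_sqrt A x.
Let L_cvg x : sqrt_seq A ^~ x @ \oo --> L x.
Proof. exact: sqrt_seq_cvg. Qed.

Let L_norm x : `|L x| <= `|x|.
Proof.
rewrite [leRHS]nrmE; apply: (@cvg_norm_le _ _ _ _ _ (@L_cvg x)) => n.
by rewrite -nrmE sqrt_seq_contraction.
Qed.

Let L_bounded : bounded_operator L.
Proof.
apply: (@bounded_operatorI _ _ _ _ 1) => [a x y|x]; last by rewrite mul1r.
apply: (@cvg_seq_unique _ _ _ _ _ (@L_cvg _)).
have YL n : linear (sqrt_seq A n).
  by have [Y ->] := sqrt_seq_bounded n Ab; exact: linearP.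
under eq_fun do rewrite YL.
by apply: cvgD => //; apply: cvgZ => //; exact: cvg_cst.
Qed.

Let L_rec x : L x = (2^-1)%:C *: (A x + L (L x)).
Proof.
(* The diagonal limit exists because the iterates are contractions: replacing the inner
   [sqrt_seq A n x] by [L x] costs at most their distance. *)
have LL : (fun n => sqrt_seq A n (sqrt_seq A n x)) @ \oo --> L (L x).
  apply/cvg_seqP => e e0; have e20 : 0 < e / 2 by rewrite divr_gt0.
  have [N1 N1P] := (cvg_seqP _ _).1 (@L_cvg (L x)) _ e20.
  have [N2 N2P] := (cvg_seqP _ _).1 (@L_cvg x) _ e20.
  exists (maxn N1 N2) => n; rewrite geq_max => /andP[/N1P h1 /N2P h2].
  rewrite -(subrKA (sqrt_seq A n (L x))) (le_lt_trans (ler_normD _ _)) //.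
  rewrite [e]splitr rmorphD ltrD // (le_lt_trans _ h2) //.
  have [Y Y_eq] := sqrt_seq_bounded n Ab.
  by rewrite Y_eq -linearB -Y_eq sqrt_seq_contraction.
apply: (@cvg_seq_unique _ _ (fun n => sqrt_seq A n.+1 x)).
  by rewrite (cvg_shiftS (sqrt_seq A ^~ x)).
apply: cvgZ; first exact: cvg_cst.
by apply: cvgD; first exact: cvg_cst.
Qed.

Lemma contr_sqrt_bounded : bounded_operator (contr_sqrt A).
Proof.
rewrite (_ : contr_sqrt A = fun x => x - L x).
  exact: bounded_operatorB (bounded_operator_id _) L_bounded.
by apply/funext => x; rewrite /L subKr.
Qed.

(** The fixed-point equation [2 L = A + L^2] rearranges to [(1 - L)^2 = 1 - A]. *)
Lemma contr_sqrt_sqr x : contr_sqrt A (contr_sqrt A x) = x - A x.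
Proof.
have S_def z : contr_sqrt A z = z - L z by rewrite /L subKr.
have := L_rec x; rewrite !S_def; have [{}L_ ->] := L_bounded.
rewrite linearB => Lx.
have {Lx} -> : A x = L_ x + L_ x - L_ (L_ x).
  rewrite -mulr2n -scaler_nat {1}Lx scalerA.
  have -> : 2%:R * (2^-1)%:C = 1 :> C.
    by rewrite fmorphV rmorph_nat divff // pnatr_eq0.
  by rewrite scale1r addrK.
by rewrite !opprD !opprK !addrA.
Qed.

(** [L] is a symmetric contraction as a limit of such, so [inner (L x) x] is real and at most
    [inner x x]. *)
Lemma contr_sqrt_ge0 x : 0 <= inner (contr_sqrt A x) x.
Proof.
have -> : contr_sqrt A x = x - L x by rewrite /L subKr.
have Y_sym n : forall y z, inner (sqrt_seq A n y) z = inner y (sqrt_seq A n z).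
  elim: n => [|n IH] y z /=; first by rewrite inner0l inner0r.
  rewrite innerZl innerZr innerDl innerDr A_sym !IH.
  by congr (_ * _); exact/esym/conjc_real.
have L_sym : inner (L x) x = inner x (L x).
  by apply: (@cvg_inner_eq _ _ _ _ _ _ _ _ (@L_cvg x) (@L_cvg x)) => n; exact: Y_sym.
have L_real : inner (L x) x \is Num.real.
  by apply/CrealP; rewrite -innerC L_sym.
rewrite innerBl subr_ge0 (le_trans (real_ler_norm L_real)) //.
by rewrite (le_trans (norm_inner_le _ _)) // innerxx expr2 ler_wpM2r.
Qed.

End contraction.

Lemma positive_symmetric (H : hilbertType C) (P : 'L(H, H)) :
  (forall x, 0 <= inner (P x) x) -> forall x y, inner (P x) y = inner x (P y).
Proof.
move=> P0 x y; apply/subr0_eq.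
apply: (@sesquilinear_eq0 _ _ (fun x y => inner (P x) y - inner x (P y))).
- by move=> *; rewrite linearD !innerDl; ring.
- by move=> *; rewrite linearZ !innerZl; ring.
- by move=> *; rewrite linearD !innerDr; ring.
- by move=> *; rewrite linearZ !innerZr; ring.
- by move=> z; rewrite [inner z _]innerC (geC0_conj (P0 z)) subrr.
Qed.

(** Positivity at [x - M^-1 *: P x], with [M] bounding [P], gives
    [0 <= - M^-1 * inner (P x) (P x)]. *)
Lemma positive_kernel (H : hilbertType C) (P : 'L(H, H)) x :
  (forall x, 0 <= inner (P x) x) -> inner (P x) x = 0 -> P x = 0.
Proof.
move=> P0 Px0; have P_sym := positive_symmetric P0.
have [M M0 PM] := bop_bounded P.
have c_conj : (M^-1)^* = M^-1 by rewrite geC0_conj // invr_ge0 ltW.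
have := P0 (x - M^-1 *: P x).
rewrite linearB linearZ !(innerBl, innerBr) !(innerZl, innerZr) Px0.
rewrite [inner (P (P x)) x]P_sym c_conj.
have := PM (P x); have h : inner (P (P x)) (P x) <= M * inner (P x) (P x).
  rewrite -(ger0_norm (P0 _)) (le_trans (norm_inner_le _ _)) // innerxx expr2 mulrA.
  by rewrite ler_wpM2r.
move=> _ h2; apply: inner_eq0; apply/eqP; rewrite eq_le inner_ge0 andbT.
have {h} : M^-1 * (M^-1 * inner (P (P x)) (P x)) <= M^-1 * inner (P x) (P x).
  by rewrite ler_pM2l ?invr_gt0 // ler_pdivrMl.
set a := M^-1 * (M^-1 * _) in h2 *; set b := M^-1 * _ in h2 *.
rewrite -subr_ge0 => h.
have : 0 <= - b.
  have -> : - b = (0 - b - (b - a)) + (b - a) by ring.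
  exact: addr_ge0.
by rewrite oppr_ge0 pmulr_rle0 // invr_gt0.
Qed.

(** [P] commutes with [A = 1 - P^2], hence with the root [S]. For [y = S x - P x], [inner (S y) y +
    inner (P y) y = inner ((S^2 - P^2) x) y = 0]; both terms are nonnegative, so [S y = P y = 0],
    and then [inner y y = 0] by symmetry. *)
Lemma positive_sqrt_unique (H : hilbertType C) (A : H -> H) (P : 'L(H, H)) :
  bounded_operator A -> (forall x, `|A x| <= `|x|) ->
  (forall x y, inner (A x) y = inner x (A y)) ->
  (forall x, 0 <= inner (P x) x) -> (forall x, P (P x) = x - A x) ->
  P =1 contr_sqrt A.
Proof.
move=> Ab A1 A_sym P0 PP x.
have AE z : A z = z - P (P z) by rewrite PP subKr.
have PS : forall z, P (contr_sqrt A z) = contr_sqrt A (P z).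
  apply: contr_sqrt_intertwine => //; first exact: bounded_operator_bop.
  by move=> z; rewrite !AE linearB.
have SS := contr_sqrt_sqr Ab A1; have S0 := contr_sqrt_ge0 Ab A1 A_sym.
have [S SE] := contr_sqrt_bounded Ab A1; rewrite SE in PS SS S0 *.
pose y := S x - P x.
have : inner (S y) y + inner (P y) y = 0.
  by rewrite -innerDl /y !linearB PS SS PP subrKA subrr inner0l.
move/eqP; rewrite paddr_eq0 // => /andP[/eqP Sy /eqP Py].
apply/esym/subr0_eq; rewrite -/y; apply: inner_eq0.
rewrite {1}/y innerBl !positive_symmetric // ?(positive_kernel S0 Sy) //.
by rewrite (positive_kernel P0 Py) subrr.
Qed.

(** * Defect operators of a contraction *)

Section defect.
Variables (H K : hilbertType C) (A : H -> K).
Hypothesis Ab : bounded_operator A.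
Hypothesis A1 : forall x, `|A x| <= `|x|.

Let AAb : bounded_operator (fun x => adj A (A x)).
Proof. exact: bounded_operator_comp (bounded_operator_bop _) Ab. Qed.

Let AA1 x : `|adj A (A x)| <= `|x|.
Proof. exact: le_trans (adj_norm_le Ab A1 _) (A1 _). Qed.

Let AA_sym x y : inner (adj A (A x)) y = inner x (adj A (A y)).
Proof. by rewrite adjEr // adjE. Qed.

Lemma defectP : (forall x, 0 <= inner (defect A x) x) /\
  (forall x, defect A (defect A x) = x - adj A (A x)).
Proof.
have SS := contr_sqrt_sqr AAb AA1; have S0 := contr_sqrt_ge0 AAb AA1 AA_sym.
have [S SE] := contr_sqrt_bounded AAb AA1; rewrite SE in SS S0.
exact: (the_opP (P := [set B : 'L(H, H) | (forall x, 0 <= inner (B x) x) /\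
  B \o B =1 fun x => x - adj A (A x)]) (conj S0 SS)).
Qed.

Lemma defect_sqr x : defect A (defect A x) = x - adj A (A x).
Proof. by have [_ ->] := defectP. Qed.

Lemma defect_symmetric x y : inner (defect A x) y = inner x (defect A y).
Proof. by apply: positive_symmetric; have [] := defectP. Qed.

Lemma defect_norm x : `|defect A x| ^+ 2 = `|x| ^+ 2 - `|A x| ^+ 2.
Proof.
by rewrite -!innerxx defect_symmetric defect_sqr innerBr -adjE.
Qed.

Lemma defect_unique (P : H -> H) : bounded_operator P ->
  (forall x, 0 <= inner (P x) x) -> (forall x, P (P x) = x - adj A (A x)) ->
  defect A =1 P.
Proof.
move=> [{}P ->] P0 PP x; have [D0 DD] := defectP.
by rewrite (positive_sqrt_unique AAb) // -(positive_sqrt_unique AAb AA1 AA_sym P0).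
Qed.

Lemma defectE : defect A =1 contr_sqrt (fun x => adj A (A x)).
Proof.
by have [D0 DD] := defectP; exact: positive_sqrt_unique.
Qed.

End defect.

(** [A] intertwines [A^* A] with [A A^*], hence also the roots of their complements. *)
Lemma defect_intertwine (H K : hilbertType C) (A : H -> K) :
  bounded_operator A -> (forall x, `|A x| <= `|x|) ->
  forall x, A (defect A x) = defect (adj A) (A x).
Proof.
move=> Ab A1 x; have A1' := adj_norm_le Ab A1.
have Ab' := bounded_operator_bop (adj A).
have A1'' := adj_norm_le Ab' A1'; have Ab'' := bounded_operator_bop (adj (adj A)).
rewrite !defectE //; apply: contr_sqrt_intertwine => // [|z||z|z].
- exact: bounded_operator_comp Ab' Ab.
- exact: le_trans (A1' _) (A1 _).
- exact: bounded_operator_comp Ab'' Ab'.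
- exact: le_trans (A1'' _) (A1' _).
- by rewrite adjK.
Qed.

End positive_square_root.

(** * Unitaries between closures of ranges *)

Section range_closure_operators.
Variable R : realType.
Local Notation C := R[i].
Local Notation "x %:C" := (real_complex R x) : ring_scope.

(** Proof irrelevance for the linearity and continuity fields; it turns pointwise uniqueness of the
    two isometries into uniqueness as operators. *)
Lemma bop_eq (H K : hilbertType C) (A B : 'L(H, K)) : A =1 B -> A = B.
Proof.
move=> /funext; case: A => -[f [[fD] [fZ]]] fc; case: B => -[g [[gD] [gZ]]] gc /= fg.
rewrite -{}fg in gD gZ gc *.
rewrite (Prop_irrelevance gD fD) (Prop_irrelevance gZ fZ) in gc *.
by rewrite (Prop_irrelevance gc fc).
Qed.

Lemma isometry_unitary (H K : hilbertType C) (U : 'L(H, K)) :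
  (forall x, `|U x| = `|x|) -> (forall y, exists x, U x = y) -> unitary U.
Proof.
move=> U_iso U_surj; have Ub := bounded_operator_bop U.
have UU x y : inner (U x) (U y) = inner x y.
  apply/subr0_eq.
  apply: (@sesquilinear_eq0 _ _ (fun x y => inner (U x) (U y) - inner x y)).
  - by move=> *; rewrite linearD !innerDl; ring.
  - by move=> *; rewrite linearZ !innerZl; ring.
  - by move=> *; rewrite linearD !innerDr; ring.
  - by move=> *; rewrite linearZ !innerZr; ring.
  - by move=> z; rewrite !innerxx U_iso subrr.
have UK : cancel U (adj U).
  by move=> x; apply: inner_inj => y; rewrite adjEr ?UU.
by split=> // y; have [x <-] := U_surj y; rewrite UK.
Qed.

Lemma unitaryN (H K : hilbertType C) (U V : 'L(H, K)) :
  unitary U -> (forall x, V x = - U x) -> unitary V.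
Proof.
move=> [UK KU] VE.
have adjV y : adj V y = - adj U y.
  move: y; apply: (adj_unique (bounded_operator_bop V) (B := fun y => - adj U y)) => x y.
  by rewrite VE innerNl innerNr -(adjE (bounded_operator_bop U)).
by split=> x; rewrite adjV VE linearN opprK.
Qed.

Lemma isometric_seq_cvg (H K : completeNormedModType C) (x : nat -> H)
    (y : nat -> K) (l : H) :
  (forall n m, `|y n - y m| = `|x n - x m|) -> x @ \oo --> l ->
  exists m : K, y @ \oo --> m.
Proof.
move=> yx /cvg_seqP xl; apply: cauchy_seq_cvg => e e0.
have [N NP] := xl _ (divr_gt0 e0 (ltr0Sn R 1)); exists N => n Nn.
rewrite yx [e]splitr -(subrKA l) (le_lt_trans (ler_normD _ _)) // rmorphD.
by rewrite ltrD // ?NP // distrC NP.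
Qed.

Lemma cvg_isometric (H K : normedModType C) (x : nat -> H) (y : nat -> K) (l : H)
    (m : K) :
  (forall n, `|x n| = `|y n|) -> x @ \oo --> l -> y @ \oo --> m -> `|l| = `|m|.
Proof.
suff le (H' K' : normedModType C) (x' : nat -> H') (y' : nat -> K') (l' : H')
    (m' : K') : (forall n, `|x' n| = `|y' n|) -> x' @ \oo --> l' ->
    y' @ \oo --> m' -> `|l'| <= `|m'|.
  move=> xy xl ym; apply/le_anti/andP.
  by split; [exact: (le _ _ x y) | exact: (le _ _ y x)].
move=> xy /cvg_seqP xl /cvg_seqP ym; rewrite !nrmE lecR; apply/ler_addgt0Pr => e e0.
have e20 : 0 < e / 2 by rewrite divr_gt0.
have [N1 /(_ _ (leq_maxl N1 _)) N1P] := xl _ e20.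
have [N2 /(_ _ (leq_maxr _ N2)) N2P] := ym _ e20.
move: (N1P N2) (N2P N1); set n := maxn N1 N2 => h1 h2.
have := ler_normD (l' - x' n) (x' n); have := ler_normD (y' n - m') m'.
rewrite !subrK xy [`|y' n - m'|]distrC; move: h1 h2.
rewrite (nrmE (l' - _)) (nrmE (m' - _)) (nrmE (y' n)) (nrmE l') (nrmE m').
by rewrite -!rmorphD !lecR !ltcR; lra.
Qed.

Section range_closure.
Variables (E K : hilbertType C) (A : 'L(E, K)).

Lemma corestrP a x y : corestr A (a *: x + y) = a *: corestr A x + corestr A y.
Proof. by apply: val_inj; rewrite /= linearP. Qed.

Lemma range_closure_dense (x : range_closure A) :
  exists u : nat -> E, (fun n => corestr A (u n)) @ \oo --> x.
Proof.
have /set_mem/closure_normP xA := valP x.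
have /choice[u uP] (n : nat) : exists y, `|x - corestr A y| < (n.+1%:R^-1)%:C.
  have [|_ [y _ <-] xy] := xA (n.+1%:R^-1)%:C; first by rewrite ltcR invr_gt0.
  by exists y.
exists u; apply/cvg_seqP => e e0.
have /cvgrPdist_lt/(_ e e0)[N _ NP] := @cvg_harmonic R.
exists N => n /NP; rewrite /= sub0r normrN ger0_norm ?invr_ge0 // => ne.
by rewrite (lt_trans (uP n)) // ltcR.
Qed.

Lemma range_closure_eq (L : hilbertType C) (V W : range_closure A -> L) :
  bounded_operator V -> bounded_operator W ->
  (forall x, V (corestr A x) = W (corestr A x)) -> V =1 W.
Proof.
move=> [{}V ->] [{}W ->] VW x; have [u ux] := range_closure_dense x.
apply: (@cvg_seq_unique _ _ (fun n => V (corestr A (u n)))).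
  exact: (@cvg_bop _ _ _ V _ _ ux).
under eq_fun do rewrite VW.
exact: (@cvg_bop _ _ _ W _ _ ux).
Qed.

End range_closure.

(** The norm identity makes [A x |-> B (G x)] a well-defined isometry between the ranges; it extends
    to the closures, and surjectivity of [G] makes the extension onto. *)
Lemma range_closure_unitary (E F K L : hilbertType C) (A : 'L(E, K)) (B : 'L(F, L))
    (G : E -> F) :
  linear G -> (forall y, exists x, G x = y) -> (forall x, `|B (G x)| = `|A x|) ->
  exists2 V : 'L(range_closure A, range_closure B),
    forall x, V (corestr A x) = corestr B (G x) & unitary V.
Proof.
move=> G_lin G_surj BG.
have GB u v : G (u - v) = G u - G v.
  by rewrite addrC -scaleN1r G_lin scaleN1r addrC.
have AB u v : corestr A (u - v) = corestr A u - corestr A v.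
  by rewrite addrC -scaleN1r corestrP scaleN1r addrC.
have BB u v : corestr B (u - v) = corestr B u - corestr B v.
  by rewrite addrC -scaleN1r corestrP scaleN1r addrC.
have iso u v : `|corestr B (G u) - corestr B (G v)| = `|corestr A u - corestr A v|.
  by rewrite -BB -GB -AB; exact: BG.
(* Graph of the extension: [w] is the limit of [B (G (u n))] along some [u] with [A (u n)] tending
   to [x]. It is linear and norm-preserving, hence functional; isometric images of convergent
   sequences converge, hence it is total and onto. *)
pose rel (x : range_closure A) (w : range_closure B) := exists u : nat -> E,
  (fun n => corestr A (u n)) @ \oo --> x /\
  (fun n => corestr B (G (u n))) @ \oo --> w.
have rel_norm x w : rel x w -> `|w| = `|x|.
  by move=> [u [ux uw]]; apply: cvg_isometric uw ux => n; exact: BG.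
have rel_lin a x w x' w' : rel x w -> rel x' w' -> rel (a *: x + x') (a *: w + w').
  move=> [u [ux uw]] [v [vx vw]]; exists (fun n => a *: u n + v n); split.
    under eq_fun do rewrite corestrP.
    by apply: cvgD => //; apply: cvgZ => //; exact: cvg_cst.
  under eq_fun do rewrite G_lin corestrP.
  by apply: cvgD => //; apply: cvgZ => //; exact: cvg_cst.
have rel_fun x w w' : rel x w -> rel x w' -> w = w'.
  move=> xw xw'; apply/subr0_eq/normr0_eq0.
  rewrite addrC -scaleN1r (rel_norm _ _ (rel_lin _ _ _ _ _ xw' xw)).
  by rewrite scaleN1r addNr normr0.
have rel_total x : exists w, rel x w.
  have [u ux] := range_closure_dense x.
  have [|w uw] := @isometric_seq_cvg _ _ _ (fun n => corestr B (G (u n))) _ _ ux.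
    by move=> n m; exact: iso.
  by exists w, u.
have rel_surj w : exists x, rel x w.
  have [v vw] := range_closure_dense w.
  have /choice[g gG] := G_surj.
  have [|x ux] := @isometric_seq_cvg _ _ _ (fun n => corestr A (g (v n))) _ _ vw.
    by move=> n m; rewrite -iso !gG.
  by exists x, (g \o v); split => //=; under eq_fun do rewrite gG.
have /choice[V VP] := rel_total.
have [] := @bounded_operatorI _ _ _ V 1.
- by move=> a x y; apply: rel_fun (VP _) _; exact: rel_lin.
- by move=> x; rewrite mul1r (rel_norm _ _ (VP x)).
move=> V' VV'; rewrite VV' in VP; exists V' => [x|].
  apply: rel_fun (VP _) _; exists (fun=> x); split; exact: cvg_cst.
apply: isometry_unitary => [x|w]; first exact: rel_norm.
by have [x xw] := rel_surj w; exists x; exact: rel_fun (VP x) xw.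
Qed.

End range_closure_operators.

(** * The automorphism of the ball and row operators *)

Section vdot.
Variables (C : numClosedFieldType) (n : nat).
Implicit Types z w lam : 'rV[C]_n.

Lemma vdotl a x y z : vdot (a *: x + y) z = a * vdot x z + vdot y z :> C.
Proof.
rewrite /vdot mulr_sumr -big_split; apply: eq_bigr => i _ /=.
by rewrite !mxE mulrDl mulrA.
Qed.

Lemma vdotC z w : vdot w z = (vdot z w)^* :> C.
Proof.
rewrite /vdot rmorph_sum; apply: eq_bigr => i _ /=.
by rewrite rmorphM /= conjCK mulrC.
Qed.

Lemma vdotr a x y z : vdot z (a *: x + y) = a^* * vdot z x + vdot z y :> C.
Proof. by rewrite vdotC vdotl rmorphD rmorphM /= -!vdotC. Qed.

Lemma vdotZl a x z : vdot (a *: x) z = a * vdot x z :> C.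
Proof. by rewrite /vdot mulr_sumr; apply: eq_bigr => i _; rewrite mxE mulrA. Qed.

Lemma vdotZr a x z : vdot z (a *: x) = a^* * vdot z x :> C.
Proof. by rewrite vdotC vdotZl rmorphM /= -vdotC. Qed.

Lemma vdot0r z : vdot z 0 = 0 :> C.
Proof. by rewrite /vdot big1 // => i _; rewrite mxE rmorph0 mulr0. Qed.

Lemma vdot_ge0 z : 0 <= vdot z z.
Proof. by apply: sumr_ge0 => i _; exact: mul_conjC_ge0. Qed.

Lemma vdot_eq0 z : vdot z z = 0 -> z = 0.
Proof.
move=> /eqP; rewrite psumr_eq0 => [/allP z0|i _]; last exact: mul_conjC_ge0.
apply/rowP => i; rewrite mxE; apply/eqP.
by have := z0 i (mem_index_enum i); rewrite /= mul_conjC_eq0.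
Qed.

Lemma vdot_ball_lt1 z lam : unit_ball z -> unit_ball lam -> `|vdot z lam| < 1.
Proof.
rewrite /unit_ball /= => z1 lam1.
rewrite -(@ltr_pXn2r _ 2) ?nnegrE // expr1n.
apply: (@le_lt_trans _ _ (vdot z z * vdot lam lam)).
  by apply: inner_CauchySchwarz => *; [exact: vdotl|exact: vdotC|
    exact: vdot_ge0|exact: vdot_eq0].
by rewrite (le_lt_trans _ z1) // ler_piMr ?vdot_ge0 // ltW.
Qed.

Section ball.
Variable lam : 'rV[C]_n.
Hypothesis lam1 : unit_ball lam.
Local Notation s := (vdefect lam).

Lemma vdefect_gt0 : 0 < s.
Proof. by rewrite sqrtC_gt0 subr_gt0. Qed.

Lemma vdefect_sqr : s ^+ 2 = 1 - vdot lam lam.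
Proof. exact: sqrtCK. Qed.

Lemma vdefect_le1 : s <= 1.
Proof.
rewrite -(@ler_pXn2r _ 2) ?nnegrE ?(ltW vdefect_gt0) // expr1n vdefect_sqr.
by rewrite gerBl vdot_ge0.
Qed.

Lemma vdefect_conj : s^* = s.
Proof. by rewrite geC0_conj // ltW // vdefect_gt0. Qed.

Lemma vdot_vproj z : vdot (vproj lam z) lam = vdot z lam.
Proof.
(* For [lam = 0] the pairings on both sides vanish. *)
have [l0|l0] := eqVneq (vdot lam lam) 0; last by rewrite vdotZl divfK.
by rewrite /vproj [in LHS](vdot_eq0 l0) (vdot_eq0 l0) scaler0 !vdot0r.
Qed.

(** The classical identity [1 - |phi z|^2 = s^2 (1 - |z|^2) / |c|^2]. *)
Lemma phi_ball z : unit_ball z -> unit_ball (phi lam z).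
Proof.
move=> z1; have s0 := vdefect_gt0.
rewrite /unit_ball /= -subr_gt0.
have [c cE] : exists c, c = 1 - vdot z lam by exists (1 - vdot z lam).
have c0 : c != 0.
  rewrite cE; apply: contraTneq (vdot_ball_lt1 z1 lam1) => /subr0_eq <-.
  by rewrite normr1 ltxx.
have cc0 : c^* != 0 by rewrite conjC_eq0.
pose p := z - (1 - s) *: vproj lam z.
have pE : p = (- (1 - s)) *: vproj lam z + z by rewrite /p scaleNr addrC.
have p_lam : vdot p lam = s * vdot z lam by rewrite pE vdotl vdot_vproj; ring.
(* [p] scales the component of [z] along [lam] by [s] and keeps the orthogonal one, so [|p|^2] is
   [|z|^2] minus [1 - s^2 = |lam|^2] times the square of the former. *)
have p_p : vdot p p = vdot z z - vdot z lam * (vdot z lam)^*.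
  have vp : vdot (vproj lam z) z = vdot (vproj lam z) (vproj lam z).
    rewrite [RHS]vdotZr vdot_vproj vdotZl [vdot lam z]vdotC.
    by rewrite rmorphM fmorphV /= (geC0_conj (vdot_ge0 lam)) mulrAC -mulrA mulrC.
  have -> : vdot z lam * (vdot z lam)^* = (1 - s ^+ 2) * vdot (vproj lam z) (vproj lam z).
    rewrite vdefect_sqr subKr {1}/vproj vdotZl [vdot lam (vproj _ _)]vdotC vdot_vproj.
    have [l0|l0] := eqVneq (vdot lam lam) 0; last by rewrite mulrA [_ / _ ]mulrC mulVKf.
    by rewrite (vdot_eq0 l0) !vdot0r !mul0r.
  rewrite pE vdotl !vdotr [vdot z (vproj _ _)]vdotC vp.
  rewrite (geC0_conj (vdot_ge0 _)) rmorphN rmorphB rmorph1 /= vdefect_conj; ring.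
have -> : phi lam z = (- (s / c)) *: p + lam by rewrite /phi -cE scaleNr addrC.
rewrite vdotl !vdotr p_p [vdot lam p]vdotC p_lam.
rewrite rmorphN !rmorphM fmorphV /= vdefect_conj.
have -> : vdot lam lam = 1 - s ^+ 2 by rewrite vdefect_sqr subKr.
have aE : vdot z lam = 1 - c by rewrite cE subKr.
rewrite aE rmorphB rmorph1 /=.
have -> : 1 - (- (s / c) * (- (s / c^* ) * (vdot z z - (1 - c) * (1 - c^* ))
     + s * (1 - c))
   + (- (s / c^* ) * (s * (1 - c^* )) + (1 - s ^+ 2))) =
   s ^+ 2 * (1 - vdot z z) / (c * c^* ).
  by field; rewrite c0 cc0.
by rewrite divr_gt0 ?mul_conjC_gt0 // mulr_gt0 ?exprn_gt0 ?subr_gt0.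
Qed.

End ball.
End vdot.

Section row_operators.
Variables (R : realType) (n : nat).
Local Notation C := R[i].
Local Notation "x %:C" := (real_complex R x) : ring_scope.
Variable H : hilbertType C.

Lemma hsum_coord_bounded i : bounded_operator (fun x : hsum n H => x i).
Proof.
apply: (@bounded_operatorI _ _ _ _ 1) => [a x y|x]; first by rewrite !ffunE.
by rewrite mul1r hsum_coord_le.
Qed.

Lemma row_op_bounded (S : 'I_n -> H -> H) :
  (forall i, bounded_operator (S i)) -> bounded_operator (row_op S).
Proof.
move=> Sb; apply: bounded_operator_sum => i.
exact: (bounded_operator_comp (Sb i) (hsum_coord_bounded i)).
Qed.

Lemma row_op_adj (S : 'I_n -> H -> H) (h : H) i :
  (forall i, bounded_operator (S i)) -> adj (row_op S) h i = adj (S i) h.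
Proof.
move=> Sb; have -> : adj (row_op S) h = [ffun i => adj (S i) h] :> hsum n H.
  apply: (adj_unique (row_op_bounded Sb)
    (B := fun h => [ffun i => adj (S i) h] : hsum n H)) => x y.
  rewrite inner_suml; apply: eq_bigr => j _.
  by rewrite ffunE adjE.
by rewrite ffunE.
Qed.

(** The hypothesis on the sum of the [T_i T_i^*] says that the adjoint column is contractive; taking
    the adjoint once more gives the row. *)
Lemma row_op_contraction (T : 'I_n -> 'L(H, H)) : commuting_multicontraction T ->
  forall x, `|row_op T x| <= `|x|.
Proof.
move=> [_ TT1] x; have Tb i := bounded_operator_bop (T i).
have Rb := row_op_bounded Tb; rewrite -(adjK Rb).
apply: adj_norm_le => [|h]; first exact: bounded_operator_bop.
rewrite -(@ler_pXn2r _ 2) ?nnegrE // -!innerxx; apply: le_trans (TT1 h).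
rewrite inner_suml le_eqVlt; apply/orP; left; apply/eqP; apply: eq_bigr => i _.
by rewrite row_op_adj // [RHS]adjE.
Qed.

Implicit Types (z w lam : 'rV[C]_n) (x : hsum n H) (h : H).

Lemma scal_row_bounded z : bounded_operator (@scal_row C n H z).
Proof.
apply: row_op_bounded => i; apply: bounded_operatorZ; exact: bounded_operator_id.
Qed.

Lemma scal_rowP a z w x : scal_row (a *: z + w) x = a *: scal_row z x + scal_row w x.
Proof.
rewrite /scal_row /row_op scaler_sumr -big_split; apply: eq_bigr => i _ /=.
by rewrite !mxE scalerDl scalerA.
Qed.

Lemma scal_rowZ a z x : scal_row (a *: z) x = a *: scal_row z x.
Proof.
by rewrite /scal_row /row_op scaler_sumr; apply: eq_bigr => i _; rewrite !mxE scalerA.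
Qed.

Lemma adj_scal_row z h i : adj (scal_row z) h i = (z 0 i)^* *: h.
Proof.
have zb j : bounded_operator (fun x : H => z 0 j *: x).
  exact/bounded_operatorZ/bounded_operator_id.
rewrite row_op_adj // (adj_unique (zb i) (B := fun h => (z 0 i)^* *: h)) // => x y.
by rewrite innerZl innerZr conjCK.
Qed.

Lemma scal_row_adj z w h : scal_row z (adj (scal_row w) h) = vdot z w *: h.
Proof.
rewrite /scal_row {1}/row_op /vdot scaler_suml; apply: eq_bigr => i _.
by rewrite adj_scal_row scalerA.
Qed.

Lemma adj_scal_row_norm_le z h : `|adj (scal_row z) h| <= sqrtC (vdot z z) * `|h|.
Proof.
have v0 := vdot_ge0 z; have zb := scal_row_bounded z.
have q0 : 0 <= sqrtC (vdot z z) by rewrite sqrtC_ge0.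
rewrite -(@ler_pXn2r _ 2) ?nnegrE ?(mulr_ge0 q0) // exprMn -!innerxx sqrtCK.
by rewrite -adjE // scal_row_adj innerZl.
Qed.

Lemma scal_row_norm_le z x : `|scal_row z x| <= sqrtC (vdot z z) * `|x|.
Proof.
have v0 := vdot_ge0 z; have zb := scal_row_bounded z.
apply: ler_norm_inner; first by rewrite mulr_ge0 // sqrtC_ge0.
rewrite -innerxx -(ger0_norm (inner_ge0 _)) adjE // (le_trans (norm_inner_le _ _)) //.
by rewrite mulrC [leRHS]mulrAC ler_wpM2r // adj_scal_row_norm_le.
Qed.

Lemma ball_radius z : unit_ball z -> exists2 q : R, 0 <= q < 1 & sqrtC (vdot z z) = q%:C.
Proof.
move=> z1; have v0 := vdot_ge0 z.
have q0 : 0 <= sqrtC (vdot z z) by rewrite sqrtC_ge0.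
exists (complex.Re (sqrtC (vdot z z))); last by rewrite RRe_real // ger0_real.
rewrite -ler0c -ltcR RRe_real ?ger0_real // q0 rmorph1.
by rewrite -sqrtC1 ltr_sqrtC ?nnegrE.
Qed.

(** Here [sqrtC (vdot z z)] is [|z| < 1], so the Neumann series applies; all the resolvents below
    are instances. *)
Lemma op_inv_contraction (E : hilbertType C) (A : E -> E) z : unit_ball z ->
  bounded_operator A -> (forall y, `|A y| <= sqrtC (vdot z z) * `|y|) ->
  cancel (fun y => y - A y) (op_inv (fun y => y - A y)) /\
  cancel (op_inv (fun y => y - A y)) (fun y => y - A y).
Proof.
move=> /ball_radius[q q1 ->] Ab Aq.
have [B [AB BA]] := one_sub_invertible Ab q1 Aq.
by apply: op_invP AB BA; exact: bounded_operator_bop.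
Qed.

Lemma scal_row_contraction z : unit_ball z -> forall x, `|scal_row z x| <= `|x|.
Proof.
move=> z1 x; rewrite (le_trans (scal_row_norm_le z x)) // ler_piMl //.
have [q /andP[_ q1] ->] := ball_radius z1.
by rewrite -(rmorph1 (real_complex R)) lecR ltW.
Qed.

Section scalar_defect.
Variable lam : 'rV[C]_n.
Hypothesis lam1 : unit_ball lam.
Local Notation s := (vdefect lam).
Local Notation l := (@scal_row C n H lam).

Let lb : bounded_operator l := scal_row_bounded lam.
Let l1 := scal_row_contraction lam1.

Lemma defect_adj_scal_row h : defect (adj l) h = s *: h.
Proof.
apply: defect_unique => [|||x|x].
- exact: bounded_operator_bop.
- exact: adj_norm_le.
- exact/bounded_operatorZ/bounded_operator_id.
- by rewrite innerZl mulr_ge0 ?inner_ge0 // ltW // vdefect_gt0.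
- rewrite adjK // scal_row_adj scalerA -expr2 vdefect_sqr //.
  by rewrite scalerBl scale1r.
Qed.

(** As [l l^* = |lam|^2], the operator [l^* l / |lam|^2] is the projection onto the range of [l^*],
    on which the root acts as [s]. For [lam = 0] the quotient is 0 and the formula gives the
    identity. *)
Lemma defect_scal_row x :
  defect l x = x - ((1 - s) / vdot lam lam) *: adj l (l x).
Proof.
set k := (1 - s) / _.
have s0 := vdefect_gt0 lam1; have s1 := vdefect_le1 lam1; have v0 := vdot_ge0 lam.
have k0 : 0 <= k by rewrite divr_ge0 // subr_ge0.
have l_lin := linearP (adj l).
move: x; apply: defect_unique => // [|x|x].
- apply: bounded_operatorB; first exact: bounded_operator_id.
  apply: bounded_operatorZ; apply: (bounded_operator_comp _ lb).
  exact: bounded_operator_bop.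
- rewrite innerBl innerZl adjEr // !innerxx subr_ge0.
  apply: (@le_trans _ _ (k * (vdot lam lam * `|x| ^+ 2))).
    rewrite ler_wpM2l // -(sqrtCK (vdot lam lam)) -exprMn.
    have q0 : 0 <= sqrtC (vdot lam lam) by rewrite sqrtC_ge0.
    by rewrite ler_pXn2r ?nnegrE ?(mulr_ge0 q0) // scal_row_norm_le.
  rewrite mulrA ler_piMl ?exprn_ge0 // /k.
  have [->|v1] := eqVneq (vdot lam lam) 0; first by rewrite mulr0 ler01.
  by rewrite divfK // lerBlDr lerDl ltW.
- have [v0'|v0'] := eqVneq (vdot lam lam) 0.
    have lx : l x = 0.
      apply/normr0_eq0/eqP; rewrite eq_le normr_ge0 andbT.
      by rewrite (le_trans (scal_row_norm_le _ _)) // v0' sqrtC0 mul0r.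
    by rewrite lx linear0 scaler0 subr0 lx linear0 scaler0 subr0.
  have [L LE] := lb.
  have lD : l (x - k *: adj l (l x)) = s *: l x.
    rewrite {1}LE linearB linearZ /= -LE scal_row_adj scalerA /k.
    by rewrite divfK // -{1}[l x]scale1r -scalerBl subKr.
  rewrite lD [adj l (s *: _)]linearZ /= -addrA -opprD scalerA -scalerDl.
  (* This coefficient is 1, because [1 - s^2 = |lam|^2]. *)
  have -> : k + k * s = (1 - s ^+ 2) / vdot lam lam by rewrite /k; field.
  by rewrite vdefect_sqr // subKr divff // scale1r.
Qed.

End scalar_defect.
End row_operators.

(** * The characteristic function on the range of the defect operator *)

Section characteristic_function.
Variables (R : realType) (n : nat).
Local Notation C := R[i].
Local Notation "x %:C" := (real_complex R x) : ring_scope.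
Variables (H : hilbertType C) (S : 'I_n -> H -> H) (z : 'rV[C]_n).
Local Notation A := (row_op S).
Local Notation Iz := (op_inv (fun h => h - scal_row z (adj A h))).
Hypothesis Ab : bounded_operator A.
Hypothesis A1 : forall x, `|A x| <= `|x|.
Hypothesis z1 : unit_ball z.

Lemma theta_inv : cancel (fun h => h - scal_row z (adj A h)) Iz /\
  cancel Iz (fun h => h - scal_row z (adj A h)).
Proof.
apply: (op_inv_contraction (A := fun h => scal_row z (adj A h)) z1) => [|h].
  exact: bounded_operator_comp (scal_row_bounded _ _) (bounded_operator_bop _).
rewrite (le_trans (scal_row_norm_le _ _)) // ler_wpM2l ?sqrtC_ge0 ?vdot_ge0 //.
exact: adj_norm_le.
Qed.

(* [theta_S(z) D_S = D_{S^*} (1 - z S^* )^-1 (z - S)]. *)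
Lemma theta_val (x : hsum n H) : defect_incl (theta S z (defect_elt A x)) =
  defect (adj A) (Iz (scal_row z x - A x)).
Proof.
have [IzK KIz] := theta_inv.
pose F (d : defect_space A) := - A (defect_incl d) +
  defect (adj A) (Iz (scal_row z (defect A (defect_incl d)))).
have FE y : F (defect_elt A y) = defect (adj A) (Iz (scal_row z y - A y)).
  have [B BE] := Ab; have [Z ZE] := scal_row_bounded H z.
  rewrite /F /defect_incl /= defect_intertwine // defect_sqr //.
  rewrite addrC -linearB; congr (defect _ _).
  have KIz' h : Iz h - scal_row z (adj A (Iz h)) = h := KIz h.
  (* What remains is [(1 - z A^* )^-1 z (1 - A^* A) - A = (1 - z A^* )^-1 (z - A)], compared after
     applying the injective [1 - z A^*]. *)
  have NB a b : a - b - scal_row z (adj A (a - b)) =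
      (a - scal_row z (adj A a)) - (b - scal_row z (adj A b)).
    by rewrite ZE (linearB (adj A)) (linearB Z) opprD addrACA -opprD.
  apply: (can_inj IzK) => /=; rewrite NB !KIz' {1}ZE (linearB Z) -ZE.
  by rewrite opprB addrA subrK.
have incl_b : bounded_operator (@defect_incl _ _ _ A).
  by apply: (@bounded_operatorI _ _ _ _ 1) => [//|d]; rewrite mul1r.
have Fb : bounded_operator F.
  apply: bounded_operatorD.
    exact/bounded_operatorN/(bounded_operator_comp Ab incl_b).
  apply: (bounded_operator_comp (bounded_operator_bop (defect (adj A)))).
  apply: (bounded_operator_comp (bounded_operator_bop Iz)).
  apply: (bounded_operator_comp (scal_row_bounded H z)).
  exact: (bounded_operator_comp (bounded_operator_bop (defect A)) incl_b).
(* [F] sends the dense vectors [D_A y] into the range of the defect of [A^*], so by continuity all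
   its values lie in the closure; hence the specification of [theta] has a solution. *)
have /choice[Th ThE] d : exists w : defect_space (adj A), defect_incl w = F d.
  have [F' F'E] := Fb; have [u ud] := range_closure_dense d.
  have Fu := @cvg_bop _ _ _ F' _ _ ud; rewrite -F'E in Fu.
  have Fd : in_range_closure (defect (adj A)) (F d).
    apply/mem_set/closure_normP => _ /gtc0_real[e e0 ->].
    have [N /(_ N (leqnn N)) FN] := (cvg_seqP _ _).1 Fu e e0.
    exists (F (defect_elt A (u N))) => //; rewrite FE.
    by exists (Iz (scal_row z (u N) - A (u N))).
  by exists (exist _ (F d) Fd).
have [F' F'E] := Fb; have [M M0 FM] := bop_bounded F'.
have [] := @bounded_operatorI _ (defect_space A) (defect_space (adj A)) Th M.
- move=> a d d'; apply: val_inj.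
  by have := linearP F' a d d'; rewrite -F'E -!ThE.
- by move=> d; have := FM d; rewrite -F'E -ThE.
move=> Th' Th'E; rewrite Th'E in ThE.
have := the_opP (P := [set Th : 'L(defect_space A, defect_space (adj A)) |
  forall d, defect_incl (Th d) = F d]) ThE.
by rewrite -/(theta S z) => ->; exact: FE.
Qed.

End characteristic_function.

(** * The characteristic function of [phi_lambda(T)] *)

Section moebius.
Variables (R : realType) (n : nat) (H : hilbertType R[i]).
Variables (T : 'I_n -> 'L(H, H)) (lam : 'rV[R[i]]_n).
Hypotheses (T_cmc : commuting_multicontraction T) (lam1 : unit_ball lam).
Local Notation s := (vdefect lam).
Local Notation l := (@scal_row _ n H lam).
Local Notation D := (defect l).
Local Notation A := (row_op T).
Local Notation Phi := (row_op (phi_tuple lam T)).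
Local Notation I1 := (op_inv (fun x => x - adj l (A x))).
Local Notation I2 := (op_inv (fun h => h - l (adj A h))).
Local Notation I3 := (op_inv (fun h => h - phi_pairing lam T h)).
Implicit Types (x y : hsum n H) (h u : H).

Let A1 x : `|A x| <= `|x|. Proof. exact: row_op_contraction. Qed.
Let Ab : bounded_operator A.
Proof. by apply: row_op_bounded => i; exact: bounded_operator_bop. Qed.
Let l1 x : `|l x| <= `|x|. Proof. exact: scal_row_contraction. Qed.
Let lb : bounded_operator l. Proof. exact: scal_row_bounded. Qed.
Let A_D x y : A (x + y) = A x + A y.
Proof. by have [B ->] := Ab; rewrite linearD. Qed.
Let A_B x y : A (x - y) = A x - A y.
Proof. by have [B ->] := Ab; rewrite linearB. Qed.
Let A_Z a x : A (a *: x) = a *: A x.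
Proof. by have [B ->] := Ab; rewrite linearZ. Qed.
Let s0 : 0 < s. Proof. exact: vdefect_gt0. Qed.
Let s_neq0 : s != 0. Proof. by rewrite gt_eqF. Qed.

Lemma phi_pairingE h : phi_pairing lam T h = A (adj l h).
Proof.
by apply: eq_bigr => i _; rewrite adj_scal_row linearZ.
Qed.

Let r0 : 0 <= sqrtC (vdot lam lam).
Proof. by rewrite sqrtC_ge0 vdot_ge0. Qed.

Let inv1 : cancel (fun x => x - adj l (A x)) I1 /\ cancel I1 (fun x => x - adj l (A x)).
Proof.
apply: (op_inv_contraction (A := fun x => adj l (A x)) lam1) => [|x].
  exact: bounded_operator_comp (bounded_operator_bop _) Ab.
by rewrite (le_trans (adj_scal_row_norm_le _ _)) // ler_wpM2l // A1.
Qed.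

Let inv2 : cancel (fun h => h - l (adj A h)) I2 /\ cancel I2 (fun h => h - l (adj A h)).
Proof. exact: theta_inv. Qed.

Let inv3 : cancel (fun h => h - phi_pairing lam T h) I3 /\
  cancel I3 (fun h => h - phi_pairing lam T h).
Proof.
have -> : phi_pairing lam T = fun h => A (adj l h) by apply/funext/phi_pairingE.
apply: (op_inv_contraction (A := fun h => A (adj l h)) lam1) => [|h].
  exact: bounded_operator_comp Ab (bounded_operator_bop _).
by rewrite (le_trans (A1 _)) // adj_scal_row_norm_le.
Qed.

Let I1E x : I1 x = x + adj l (A (I1 x)).
Proof. by apply/eqP; rewrite -subr_eq; apply/eqP; have [_ IK] := inv1; exact: IK. Qed.

Let I2E h : I2 h = h + l (adj A (I2 h)).
Proof. by apply/eqP; rewrite -subr_eq; apply/eqP; have [_ IK] := inv2; exact: IK. Qed.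

(** Push-through identity [(1 - T l^* )^-1 T = T (1 - l^* T)^-1]. *)
Let I3A x : I3 (A x) = A (I1 x).
Proof.
have [I3K _] := inv3.
rewrite -[RHS]I3K phi_pairingE; congr (I3 _).
by have AE := congr1 A (I1E x); rewrite A_D in AE; rewrite {1}AE addrK.
Qed.

Let lD x : l (D x) = s *: l x.
Proof. by rewrite defect_intertwine // defect_adj_scal_row. Qed.

Let Dl h : D (adj l h) = s *: adj l h.
Proof.
apply: inner_inj => x; rewrite defect_symmetric // adjEr // lD innerZr.
by rewrite innerZl adjEr // vdefect_conj.
Qed.

Let DD x : D (D x) = x - adj l (l x). Proof. exact: defect_sqr. Qed.

Let ll h : l (adj l h) = (1 - s ^+ 2) *: h.
Proof. by rewrite scal_row_adj vdefect_sqr // subKr. Qed.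

Let AD x : A (D x) = A x - ((1 - s) / vdot lam lam) *: A (adj l (l x)).
Proof. by rewrite defect_scal_row // A_B A_Z. Qed.

(** Links the coordinatewise functional calculus to the row formula: the brackets in [phi_tuple] sum
    to [T D x] by the explicit form of [D], and [I3A] moves the inverse across [T]. *)
Lemma row_op_phi_tuple x : Phi x = l x - s *: A (I1 (D x)).
Proof.
rewrite -I3A AD {1 2}/row_op sumrB -scaler_sumr -linear_sum sumrB.
congr (_ - _ *: I3 (_ - _)); rewrite -scaler_sumr -scalerA; congr (_ *: _).
rewrite [adj l _]linear_sum; have [B BE] := Ab; rewrite BE linear_sum scaler_sumr.
apply: eq_bigr => i _; rewrite phi_pairingE mulrC -scalerA; congr (_ *: _).
by rewrite BE !linearZ.
Qed.

Lemma row_op_phi_bounded : bounded_operator Phi.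
Proof.
rewrite (funext row_op_phi_tuple); apply: bounded_operatorB => //.
apply/bounded_operatorZ/(bounded_operator_comp Ab).
exact: bounded_operator_comp (bounded_operator_bop _) (bounded_operator_bop _).
Qed.

(** Checked by pairing: after [D x = y - l^* T y] and [s h = g - l T^* g], the nontrivial terms on
    both sides equal [inner (T y) (g - l T^* g)]. *)
Lemma row_op_phi_adj h : adj Phi h = adj l h - D (adj A (I2 (s *: h))).
Proof.
move: h; apply: (adj_unique row_op_phi_bounded
  (B := fun h => adj l h - D (adj A (I2 (s *: h))))) => x h.
cbv beta; rewrite row_op_phi_tuple innerBl innerBr (adjE lb); congr (_ - _).
rewrite -defect_symmetric //; set y := I1 (D x); set g := I2 (s *: h).
have -> : inner (s *: A y) h = inner (A y) (s *: h).
  by rewrite innerZl innerZr vdefect_conj.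
have -> : D x = y - adj l (A y) by rewrite {1}/y I1E addrK.
have -> : s *: h = g - l (adj A g) by rewrite {1}/g I2E addrK.
by rewrite innerBl innerBr (adjE Ab) (adjEr lb).
Qed.

Let inner_DD x y : inner (D x) (D y) = inner x y - inner (l x) (l y).
Proof. by rewrite defect_symmetric // DD innerBr -(adjE lb). Qed.

Let inner_adj_l h u : inner (adj l h) (adj l u) = (1 - s ^+ 2) * inner h u.
Proof. by rewrite (adjEr lb) ll innerZr rmorphB rmorph1 rmorphXn /= vdefect_conj. Qed.

Let inner_Dl x h : inner (D x) (adj l h) = s * inner (l x) h.
Proof. by rewrite -(adjE lb) lD innerZl. Qed.

Let inner_lD h x : inner (adj l h) (D x) = s * inner h (l x).
Proof. by rewrite (adjEr lb) lD innerZr vdefect_conj. Qed.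

(* The Julia operator [(x, h) |-> (l x - s h, D x + l^* h)] is isometric, and so is
   its adjoint below. *)
Let julia x h :
  `|l x - s *: h| ^+ 2 + `|D x + adj l h| ^+ 2 = `|x| ^+ 2 + `|h| ^+ 2.
Proof.
rewrite -!innerxx !(innerDl, innerDr, innerNl, innerNr).
rewrite inner_DD inner_adj_l inner_Dl inner_lD !innerZl !innerZr vdefect_conj //; ring.
Qed.

Let julia_adj x h :
  `|adj l h - D x| ^+ 2 + `|l x + s *: h| ^+ 2 = `|x| ^+ 2 + `|h| ^+ 2.
Proof.
rewrite -!innerxx !(innerDl, innerDr, innerNl, innerNr).
rewrite inner_DD inner_adj_l inner_Dl inner_lD !innerZl !innerZr vdefect_conj //; ring.
Qed.

Lemma row_op_phi_norm x :
  `|Phi x| ^+ 2 + `|I1 (D x)| ^+ 2 = `|x| ^+ 2 + `|A (I1 (D x))| ^+ 2.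
Proof.
by rewrite -julia row_op_phi_tuple {2}I1E.
Qed.

Lemma row_op_phi_contraction x : `|Phi x| <= `|x|.
Proof.
rewrite -(@ler_pXn2r _ 2) ?nnegrE //.
rewrite -(lerD2r (`|I1 (D x)| ^+ 2)) row_op_phi_norm lerD2l.
by rewrite ler_pXn2r ?nnegrE.
Qed.

Lemma adj_row_op_phi_norm h :
  `|adj Phi h| ^+ 2 + `|I2 (s *: h)| ^+ 2 = `|h| ^+ 2 + `|adj A (I2 (s *: h))| ^+ 2.
Proof.
by rewrite [RHS]addrC -[RHS]julia_adj row_op_phi_adj {2}I2E [s *: h + _]addrC.
Qed.

Let D_surj x : exists y, D y = x.
Proof.
(* From [D^2 = 1 - l^* l] and [D l^* = s l^*], the inverse of [D] is [D + s^-1 l^* l]. *)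
exists (D x + s^-1 *: adj l (l x)).
by rewrite linearD linearZ /= DD Dl scalerA mulVf // scale1r subrK.
Qed.

Lemma Omega_exists : exists2 Om, Omega_spec lam T Om & unitary Om.
Proof.
have [I1K KI1] := inv1; have Pb := row_op_phi_bounded.
apply: (@range_closure_unitary _ _ _ _ _ (defect Phi) (defect A) (fun x => I1 (D x))).
- by move=> a x y; rewrite !linearP.
- move=> y; have [x xy] := D_surj (y - adj l (A y)).
  by exists x; rewrite xy I1K.
- move=> x; apply/eqP; rewrite -(@eqrXn2 _ 2) // !defect_norm //; last first.
    exact: row_op_phi_contraction.
  by rewrite subr_eq addrAC eq_sym subr_eq -row_op_phi_norm [X in X == _]addrC.
Qed.

Lemma Omega_star_exists : exists2 Oms, Omega_star_spec lam T Oms & unitary Oms.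
Proof.
have [I2K KI2] := inv2; have Pb := row_op_phi_bounded.
have P1 := row_op_phi_contraction.
apply: (@range_closure_unitary _ _ _ _ _ (defect (adj Phi)) (defect (adj A))
  (fun h => I2 (defect (adj l) h))).
- by move=> a h h'; rewrite !linearP.
- move=> h; exists (s^-1 *: (h - l (adj A h))).
  by rewrite defect_adj_scal_row // scalerA divff // scale1r I2K.
- move=> h; apply/eqP; rewrite -(@eqrXn2 _ 2) // defect_norm ?defect_norm //.
  + by rewrite defect_adj_scal_row // subr_eq addrAC eq_sym subr_eq
      -adj_row_op_phi_norm [X in X == _]addrC.
  + exact: bounded_operator_bop.
  + exact: adj_norm_le.
  + exact: bounded_operator_bop.
  + exact: adj_norm_le.
Qed.

(** * Composition with the automorphism of the ball *)

Section composition.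
Variable z : 'rV[R[i]]_n.
Hypothesis z1 : unit_ball z.
Local Notation w := (phi lam z).
Local Notation c := (1 - vdot z lam).
Local Notation Z := (@scal_row _ n H z).
Local Notation W := (@scal_row _ n H w).

Let c_neq0 : c != 0.
Proof.
apply: contraTneq (vdot_ball_lt1 z1 lam1) => /subr0_eq <-.
by rewrite normr1 ltxx.
Qed.

Let Zb : bounded_operator Z. Proof. exact: scal_row_bounded. Qed.
Let Wb : bounded_operator W. Proof. exact: scal_row_bounded. Qed.
(** The definition of [phi] solved for [z - (1 - s) P z], whose row is [z D] by the explicit form of
    [D]. *)
Let ZD x : Z (D x) = (c / s) *: (l x - W x).
Proof.
have -> : W x = (- (s / c)) *: scal_row ((- (1 - s)) *: vproj lam z + z) x + l x.
  by rewrite -scal_rowP /phi scaleNr addrC [- _ *: _ + z]addrC scaleNr.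
rewrite scal_rowP /vproj !scal_rowZ opprD addrCA subrr addr0 -scaleNr opprK scalerA.
rewrite scalerA mulrA divfK // divff // scale1r defect_scal_row //.
have [Z' ZE] := Zb; rewrite {1}ZE linearB linearZ /= -ZE scal_row_adj addrC.
by congr (_ + _); rewrite -scaleNr scalerA -mulNr mulrAC mulrA.
Qed.

(* As [l D = s l], applying [ZD] to [D x] gives [z - lam = - (c / s) w D]. *)
Let ZDD x : Z x - l x = - ((c / s) *: W (D x)).
Proof.
have := ZD (D x); rewrite DD lD.
have [Z' ZE] := Zb; rewrite {1}ZE linearB -ZE scal_row_adj scalerBr scalerA divfK //.
rewrite scalerBl scale1r => /eqP; rewrite subr_eq => /eqP ->.
by rewrite [X in X - l x]addrAC subrK addrAC subrr add0r.
Qed.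

(** Equivalent to the classical [(1 - <w, lam>) (1 - <z, lam>) = s^2]. *)
Let Wl h : W (adj l h) = (1 - s ^+ 2 / c) *: h.
Proof.
have [Z' ZE] := Zb; have := ZD (adj l h); rewrite Dl ll ZE linearZ /= -ZE scal_row_adj.
move/(congr1 (fun u => (s / c) *: u)); rewrite !scalerA.
rewrite mulrA divfK // divff // scale1r => /eqP.
rewrite eq_sym subr_eq [_ + W _]addrC -subr_eq -scalerBl => /eqP <-.
congr (_ *: _); field; exact: c_neq0.
Qed.

(* Solves [(1 - z Phi^* ) g1 = (z - Phi) x] in terms of the solution [g] of
   [(1 - w T^* ) g = (w - T) y]: [g1 = - s^-1 (1 - lam T^* ) g]. *)
Lemma moebius_theta x :
  I2 (s *: op_inv (fun h => h - Z (adj Phi h)) (Z x - Phi x)) =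
  - op_inv (fun h => h - W (adj A h)) (W (I1 (D x)) - A (I1 (D x))).
Proof.
have [I2K _] := inv2; set y := I1 (D x).
have [_ IwK] := theta_inv Ab A1 (phi_ball lam1 z1).
have [IzK _] := theta_inv row_op_phi_bounded row_op_phi_contraction z1.
set g := op_inv _ (W y - A y).
have gE : g - W (adj A g) = W y - A y by exact: IwK.
pose g1 := - s^-1 *: (g - l (adj A g)).
have sg1 : I2 (s *: g1) = - g.
  by rewrite scalerA mulrN divff // scaleN1r linearN I2K.
suff -> : op_inv (fun h => h - Z (adj Phi h)) (Z x - Phi x) = g1 by [].
suff -> : Z x - Phi x = g1 - Z (adj Phi g1) by exact: IzK.
(* Since [I2 (s *: g1) = - g], one has [Phi^* g1 = l^* g1 + D T^* g], and [ZD] evaluates [z D]. *)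
have ZPhi : Z (adj Phi g1) = vdot z lam *: g1 + (c / s) *: (l (adj A g) - W (adj A g)).
  rewrite row_op_phi_adj sg1 (linearN (adj A)) (linearN (defect l)) opprK -ZD.
  by have [Z' ZE] := Zb; rewrite {1}ZE linearD -ZE scal_row_adj.
have WD : W (D x) = W y - (1 - s ^+ 2 / c) *: A y.
  have -> : D x = y - adj l (A y) by rewrite {1}/y I1E addrK.
  by rewrite -Wl; have [W' ->] := Wb; rewrite linearB.
rewrite ZPhi row_op_phi_tuple -/y opprD opprK addrA ZDD WD.
(* [c g1 = - (c / s) (g - l T^* g)], so the terms in [l T^* g] cancel and the equation defining [g]
   appears. *)
have -> : g1 - (vdot z lam *: g1 + (c / s) *: (l (adj A g) - W (adj A g)))
    = - ((c / s) *: (W y - A y)).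
  rewrite opprD addrA -{1}[g1]scale1r -scalerBl scalerA mulrN scaleNr.
  by rewrite -opprD -scalerDr addrA subrK gE.
(* The coefficients of [T y] agree: [(c / s) (1 - s^2 / c) + s = c / s]. *)
rewrite !scalerBr !opprB scalerA addrAC -scalerDl; congr (_ *: _ - _).
by field; rewrite s_neq0 c_neq0.
Qed.

End composition.

Let theta_elt (S : 'I_n -> H -> H) z x : unit_ball z -> bounded_operator (row_op S) ->
  (forall x, `|row_op S x| <= `|x|) ->
  theta S z (defect_elt (row_op S) x) = defect_elt (adj (row_op S))
    (op_inv (fun h => h - scal_row z (adj (row_op S) h)) (scal_row z x - row_op S x)).
Proof. by move=> z1 Sb S1; apply: val_inj; exact: theta_val. Qed.

(** Both sides are bounded in [d], so it suffices to take [d = D_Phi x], where [theta_val] reduces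
    the claim to [moebius_theta]. *)
Lemma theta_coincide Om Oms z : unit_ball z ->
  Omega_spec lam T Om -> Omega_star_spec lam T Oms ->
  forall d, - Oms (theta (phi_tuple lam T) z d) = theta T (phi lam z) (Om d).
Proof.
move=> z1 OmE OmsE; apply: range_closure_eq => [||x].
- apply/bounded_operatorN/bounded_operator_comp; exact: bounded_operator_bop.
- apply/bounded_operator_comp; exact: bounded_operator_bop.
have Pb := row_op_phi_bounded; have P1 := row_op_phi_contraction.
rewrite [theta _ _ _]theta_elt // OmsE OmE theta_elt //; last exact: phi_ball.
rewrite defect_adj_scal_row // moebius_theta //; apply: val_inj.
by rewrite /= linearN opprK.
Qed.

End moebius.

Theorem theorem5p3 (R : realType) (n : nat) (n_ge1 : (1 <= n)%N)
    (H : hilbertType R[i]) (T : 'I_n -> 'L(H, H)) (lam : 'rV[R[i]]_n)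
    (T_cmc : commuting_multicontraction T) (lam_ball : unit_ball lam) :
  (exists Om : 'L(defect_space (row_op (phi_tuple lam T)), defect_space (row_op T)),
     unique (Omega_spec lam T) Om /\ unitary Om) /\
  (exists Oms : 'L(defect_space (adj (row_op (phi_tuple lam T))),
                   defect_space (adj (row_op T))),
     unique (Omega_star_spec lam T) Oms /\ unitary Oms) /\
  coincide (theta (phi_tuple lam T)) (fun z => theta T (phi lam z)).
Proof.
have [Om OmE OmU] := Omega_exists T_cmc lam_ball.
have [Oms OmsE OmsU] := Omega_star_exists T_cmc lam_ball.
split; [|split].
- exists Om; split=> //; split=> // Om' OmE'; apply: bop_eq.
  apply: range_closure_eq => [||x]; try exact: bounded_operator_bop.
  by rewrite [LHS]OmE [RHS]OmE'.
- exists Oms; split=> //; split=> // Oms' OmsE'; apply: bop_eq.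
  apply: range_closure_eq => [||x]; try exact: bounded_operator_bop.
  by rewrite [LHS]OmsE [RHS]OmsE'.
(* The sign is absorbed by taking [- Oms] as the second unitary. *)
have [N NE] := bounded_operatorN (bounded_operator_bop Oms).
exists Om, N; split=> // [|z z1 d].
  by apply: unitaryN OmsU _ => x; rewrite -NE.
by rewrite -NE; exact: theta_coincide.
Qed.
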